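(* Let $\mathcal{G}$ be a minimal topologically principal groupoid such that $\mathcal{G}^{(0)}$ is compact. Then $\mathcal{G}$ is purely infinite if and only if $\mathcal{G}$ is almost elementary and $M(\mathcal{G})=\emptyset$.
   Context: Groupoid conventions: a groupoid $\mathcal{G}$ is a locally compact Hausdorff $\sigma$-compact étale topological groupoid, with unit space $\mathcal{G}^{(0)}$, source $s$ and range $r$. It is minimal if there are no proper nonempty closed invariant subsets of $\mathcal{G}^{(0)}$; topologically principal if the set of units with trivial isotropy group is dense in $\mathcal{G}^{(0)}$. $M(\mathcal{G})$ is the set of $\mathcal{G}$-invariant Borel probability measures on $\mathcal{G}^{(0)}$, i.e. those $\mu$ with $\mu(s(U))=\mu(r(U))$ for every open bisection $U$. Subequivalence: an open $s$-section is an open set $A\subseteq\mathcal{G}$ such that $s|_A$ is a homeomorphism onto an open subset of $\mathcal{G}^{(0)}$. For $K\subseteq\mathcal{G}^{(0)}$ and $O\subseteq\mathcal{G}^{(0)}$ open, $K\prec_{\mathcal{G}}O$ means that there is an open $s$-section $A$ with $K\subseteq r(A)$ and $s(A)\subseteq O$. For open $U,V\subseteq\mathcal{G}^{(0)}$, $U\precsim_{\mathcal{G},2}V$ means that for every compact $K\subseteq U$ there are disjoint nonempty open $V_1,V_2\subseteq V$ with $K\prec_{\mathcal{G}}V_1$ and $K\prec_{\mathcal{G}}V_2$. Purely infinite: $\mathcal{G}$ is purely infinite if $O_1\precsim_{\mathcal{G},2}O_2$ for all nonempty open $O_1,O_2\subseteq\mathcal{G}^{(0)}$ with $O_1\subseteq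 r(\mathcal{G}O_2)$, where $\mathcal{G}O_2=\{\gamma:s(\gamma)\in O_2\}$. Castles: a castle is a finite collection $\mathcal{S}$ of pairwise disjoint nonempty subsets of $\mathcal{G}$ such that (i) $r(C),s(C),C^{-1}\in\mathcal{S}$ for all $C\in\mathcal{S}$; (ii) $CD\in\mathcal{S}\cup\{\emptyset\}$ for all $C,D\in\mathcal{S}$; (iii) $C\mapsto(r(C),s(C))$ is injective on $\mathcal{S}$. It is open if all its members are open in $\mathcal{G}$. Put $\mathcal{S}^{(0)}=\{C\in\mathcal{S}:C\subseteq\mathcal{G}^{(0)}\}$. For compact $K\subseteq\mathcal{G}$, $\mathcal{S}$ is $K$-extendable to a castle $\mathcal{D}$ if every $C\in\mathcal{S}$ belongs to $\mathcal{D}$ and satisfies $(K\cup K^{-1})C\subseteq\bigcup\mathcal{D}$ and $C(K\cup K^{-1})\subseteq\bigcup\mathcal{D}$. Almost elementary: $\mathcal{G}$ with compact unit space is almost elementary if for every compact $K\subseteq\mathcal{G}$, every finite open cover $\mathcal{V}$ of $\mathcal{G}^{(0)}$ and every nonempty open $O\subseteq\mathcal{G}^{(0)}$ there is a nonempty open castle $\mathcal{S}$ such that (i) $\mathcal{S}$ is $K$-extendable to an open castle; (ii) every member of $\mathcal{S}^{(0)}$ is contained in a member of $\mathcal{V}$; (iii) $\mathcal{G}^{(0)}\setminus\bigcup\mathcal{S}^{(0)}\prec_{\mathcal{G}}O$. *)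

(* Defs.v *)
From HB Require Import structures.
From mathcomp Require Import all_boot all_order all_algebra.
From mathcomp Require Import all_classical all_reals all_analysis.

Set Implicit Arguments.
Unset Strict Implicit.
Unset Printing Implicit Defensive.

Local Open Scope classical_set_scope.
Local Open Scope ring_scope.

(* A groupoid with arrows [G] and units [X]; the unit space is identified with
   a subset of [G] through [gunit]. [gmul] is total, but only its values on
   composable pairs ([src g = rng h]) are meaningful. *)
Record groupoid (X G : Type) := Groupoid {
  src : G -> X ;
  rng : G -> X ;
  gunit : X -> G ;
  gmul : G -> G -> G ;
  ginv : G -> G ;
  src_unit : forall x, src (gunit x) = x ;
  rng_unit : forall x, rng (gunit x) = x ;
  src_mul : forall g h, src g = rng h -> src (gmul g h) = src h ;
  rng_mul : forall g h, src g = rng h -> rng (gmul g h) = rng g ;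
  mul_assoc : forall g h k, src g = rng h -> src h = rng k ->
    gmul g (gmul h k) = gmul (gmul g h) k ;
  mul_unitl : forall g, gmul (gunit (rng g)) g = g ;
  mul_unitr : forall g, gmul g (gunit (src g)) = g ;
  src_inv : forall g, src (ginv g) = rng g ;
  rng_inv : forall g, rng (ginv g) = src g ;
  mul_invr : forall g, gmul g (ginv g) = gunit (rng g) ;
  mul_invl : forall g, gmul (ginv g) g = gunit (src g)
}.

Section SetOperations.
Variables (X G : Type) (gr : groupoid X G).

Definition gprod (C D : set G) : set G :=
  [set g | exists a b, [/\ C a, D b, src gr a = rng gr b & g = gmul gr a b]].

(* The sets r(C) and s(C), seen inside [G]. *)
Definition rng_units (C : set G) : set G := gunit gr @` (rng gr @` C).
Definition src_units (C : set G) : set G := gunit gr @` (src gr @` C).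

(* The set r(G O), with G O = {g : s(g) in O}. *)
Definition saturation (O : set X) : set X := rng gr @` (src gr @^-1` O).

Definition castle (S : set (set G)) : Prop :=
  [/\ finite_set S,
      trivIset S id,
      (forall C, S C -> C !=set0),
      (forall C, S C -> [/\ S (rng_units C), S (src_units C) & S (ginv gr @` C)]) &
      (forall C D, S C -> S D -> S (gprod C D) \/ gprod C D = set0)] /\
  set_inj S (fun C => (rng gr @` C, src gr @` C)).

Definition castle_units (S : set (set G)) : set (set G) :=
  [set C | S C /\ C `<=` range (gunit gr)].

Definition extendable_to (K : set G) (S D : set (set G)) : Prop :=
  forall C, S C ->
    [/\ D C,
        gprod (K `|` ginv gr @` K) C `<=` \bigcup_(E in D) E &
        gprod C (K `|` ginv gr @` K) `<=` \bigcup_(E in D) E].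

End SetOperations.

(* [f] restricts to a homeomorphism of [A] onto [B] (subspace topologies). The
   totality of [g] costs nothing in a groupoid, where [gunit] maps [X] to [G]. *)
Definition homeomorphism_on (T U : topologicalType) (f : T -> U)
    (A : set T) (B : set U) : Prop :=
  [/\ set_bij A B f, {within A, continuous f} &
      exists g : U -> T,
        (forall x, A x -> g (f x) = x) /\ {within B, continuous g}].

Section TopologicalGroupoid.
Variables (X G : topologicalType) (gr : groupoid X G).

(* As [src] is a continuous retraction of [gunit], these conditions force the
   topology of [X] to be the one induced from [G]. *)
Definition topological_groupoid : Prop :=
  [/\ continuous (src gr), continuous (rng gr), continuous (gunit gr),
      continuous (ginv gr) &
      {within [set p : G * G | src gr p.1 = rng gr p.2],
        continuous (fun p : G * G => gmul gr p.1 p.2)}].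

Definition etale : Prop :=
  forall g : G, exists U : set G,
    [/\ open U, U g, open (rng gr @` U) &
        homeomorphism_on (rng gr) U (rng gr @` U)].

Definition sigma_compact (T : topologicalType) : Prop :=
  exists K : nat -> set T, (forall n, compact (K n)) /\ \bigcup_n K n = setT.

Definition invariant (D : set X) : Prop := saturation gr D = D.

Definition minimal : Prop :=
  forall D : set X, closed D -> invariant D -> D !=set0 -> D = setT.

Definition trivial_isotropy (x : X) : Prop :=
  [set g | src gr g = x /\ rng gr g = x] = [set gunit gr x].

Definition topologically_principal : Prop :=
  dense [set x | trivial_isotropy x].

Definition open_s_section (A : set G) : Prop :=
  [/\ open A, open (src gr @` A) &
      homeomorphism_on (src gr) A (src gr @` A)].

Definition open_r_section (A : set G) : Prop :=
  [/\ open A, open (rng gr @` A) &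
      homeomorphism_on (rng gr) A (rng gr @` A)].

Definition open_bisection (A : set G) : Prop :=
  open_s_section A /\ open_r_section A.

Definition subequivalent (K O : set X) : Prop :=
  exists A : set G,
    [/\ open_s_section A, K `<=` rng gr @` A & src gr @` A `<=` O].

Definition subequivalent2 (U V : set X) : Prop :=
  forall K : set X, compact K -> K `<=` U ->
    exists V1 V2 : set X,
      [/\ [/\ open V1, V1 !=set0 & V1 `<=` V],
          [/\ open V2, V2 !=set0 & V2 `<=` V],
          V1 `&` V2 = set0,
          subequivalent K V1 &
          subequivalent K V2].

Definition purely_infinite : Prop :=
  forall O1 O2 : set X,
    open O1 -> O1 !=set0 -> open O2 -> O2 !=set0 ->
    O1 `<=` saturation gr O2 -> subequivalent2 O1 O2.

Definition open_castle (S : set (set G)) : Prop :=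
  castle gr S /\ forall C, S C -> open C.

Definition almost_elementary : Prop :=
  forall (K : set G) (V : set (set X)) (O : set X),
    compact K ->
    finite_set V -> (forall W, V W -> open W) -> \bigcup_(W in V) W = setT ->
    open O -> O !=set0 ->
    exists S : set (set G),
      [/\ open_castle S /\ S !=set0,
          exists D : set (set G), open_castle D /\ extendable_to gr K S D,
          forall C, castle_units gr S C ->
            exists2 W, V W & C `<=` gunit gr @` W &
          subequivalent
            (~` (gunit gr @^-1` (\bigcup_(C in castle_units gr S) C))) O].

End TopologicalGroupoid.

(* The library's measurable types are pointed. [pointed_at x0] is [X] with base
   point [x0]; since a space carrying a probability measure is nonempty, letting
   [x0] range over [X] in [invariant_probabilities] yields all the Borel
   probability measures on [X], and none if [X] is empty. *)
Definition pointed_at (X : topologicalType) (x0 : X) : Type := X.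
HB.instance Definition _ (X : topologicalType) (x0 : X) :=
  Topological.on (pointed_at x0).
HB.instance Definition _ (X : topologicalType) (x0 : X) :=
  isPointed.Build (pointed_at x0) x0.

Definition borel_type (X : topologicalType) (x0 : X) :=
  g_sigma_algebraType (@open (pointed_at x0)).

(* A library measure on [borel_type x0] is a function on all subsets, of which
   only the values on Borel sets are constrained. *)
Definition invariant_probabilities (R : realType) (X G : topologicalType)
    (gr : groupoid X G) : set (set X -> \bar R) :=
  [set mu | (exists (x0 : X) (P : probability (borel_type x0) R),
                forall B : set X, mu B = P B) /\
            forall U : set G, open_bisection gr U ->
              mu (src gr @` U) = mu (rng gr @` U)].
Arguments invariant_probabilities R {X G} gr.

(* Main.v *)
(** If [G] is purely infinite, then [X] is subequivalent to two disjoint subsets of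
    itself, which no invariant probability can allow. Moreover a small
    neighbourhood [W] of a point [x] with trivial isotropy is a one-level castle:
    the finitely many arrows of [K] at [x] have distinct ranges, so bisections
    through them form an open castle extending it, while [X \ W] is subequivalent
    to any nonempty open set.

    Conversely, if there is no invariant probability, then some compact [K]
    satisfies [|K F| >= (1 + c) |F|] for all finite sets of arrows [F]: otherwise
    an ultralimit of the uniform measures on Folner sets is an invariant finitely
    additive probability, whose regularisation is Borel. Powers of [K] expand by
    any prescribed factor, so, by minimality, for every nonempty open [O] there is
    a compact set of arrows moving any finite [F] onto at least [|F|] arrows with
    range in [O]. In an almost elementary castle extendable along that set, each
    orbit thus meets [O] at least as often as the levels of the castle. Matching
    by rank sends the levels into [O]; the remainder is absorbed by another open
    set. Hence [X] is subequivalent to every nonempty open set. *)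

Require Import Defs.
From HB Require Import structures.
From mathcomp Require Import all_boot all_order all_algebra.
From mathcomp Require Import all_classical all_reals all_analysis.
From mathcomp Require Import zify lra.

Set Implicit Arguments.
Unset Strict Implicit.
Unset Printing Implicit Defensive.

Import Order.TTheory GRing.Theory Num.Theory.
Import numFieldNormedType.Exports.

Local Open Scope classical_set_scope.

(** * Groupoids *)

Section GroupoidAlgebra.
Variables (X G : Type) (gr : groupoid X G).
Local Notation s := (src gr).
Local Notation r := (rng gr).
Local Notation e := (gunit gr).
Local Notation mul := (gmul gr).
Local Notation inv := (ginv gr).

Lemma gunit_inj : injective e.
Proof. by move=> x y /(congr1 s); rewrite !src_unit. Qed.

Lemma ginvK : involutive inv.
Proof.
move=> g; rewrite -[LHS](mul_unitr gr) src_inv rng_inv -mul_invl.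
by rewrite mul_assoc ?src_inv ?rng_inv// mul_invl src_inv mul_unitl.
Qed.

Lemma gmulKg g h : s g = r h -> mul (inv g) (mul g h) = h.
Proof.
by move=> gh; rewrite mul_assoc ?src_inv// mul_invl gh mul_unitl.
Qed.

Lemma gmulgK g h : s g = r h -> mul (mul g h) (inv h) = g.
Proof.
by move=> gh; rewrite -mul_assoc ?rng_inv// mul_invr -gh mul_unitr.
Qed.

Lemma gmulgVK g h : s g = s h -> mul (mul g (inv h)) h = g.
Proof.
by move=> gh; rewrite -mul_assoc ?src_inv ?rng_inv// mul_invl -gh mul_unitr.
Qed.

Lemma gmulgI g h k : s g = r h -> s g = r k -> mul g h = mul g k -> h = k.
Proof. by move=> gh gk ghk; rewrite -(gmulKg gh) ghk gmulKg. Qed.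

Lemma gmulV_unit g h x : s g = s h -> mul g (inv h) = e x -> g = h.
Proof.
move=> gh ghx; rewrite -(gmulgVK gh) ghx.
have -> : x = r h.
  by move/(congr1 s): ghx; rewrite src_unit src_mul ?rng_inv// src_inv.
by rewrite mul_unitl.
Qed.

Lemma ginvM g h : s g = r h -> inv (mul g h) = mul (inv h) (inv g).
Proof.
move=> gh; apply: (@gmulgI (mul g h)).
- by rewrite rng_inv.
- by rewrite src_mul// rng_mul ?src_inv ?rng_inv.
rewrite mul_invr rng_mul// mul_assoc; first by rewrite gmulgK// mul_invr.
  by rewrite src_mul// rng_inv.
by rewrite src_inv rng_inv.
Qed.

Lemma image_ginv (C : set G) : inv @` C = [set g | C (inv g)].
Proof.
apply/seteqP; split=> [_ [g Cg <-]|g Cg] /=; first by rewrite ginvK.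
by exists (inv g) => //; rewrite ginvK.
Qed.

Lemma gprodP (C D : set G) g h : C g -> D h -> s g = r h ->
  gprod gr C D (mul g h).
Proof. by move=> Cg Dh gh; exists g, h. Qed.

Lemma gprodS (A B C D : set G) : A `<=` B -> C `<=` D ->
  gprod gr A C `<=` gprod gr B D.
Proof. by move=> AB CD _ [a [b [/AB Ba /CD Db ab ->]]]; exact: gprodP. Qed.

Lemma gprodA (A B C : set G) :
  gprod gr A (gprod gr B C) = gprod gr (gprod gr A B) C.
Proof.
apply/seteqP; split=> g [].
  move=> a [_ [Aa [b [c [Bb Cc bc ->]]]]]; rewrite rng_mul// => ab ->.
  by rewrite mul_assoc//; apply: gprodP; rewrite ?src_mul//; exact: gprodP.
move=> _ [c [[a [b [Aa Bb ab ->]]] Cc]]; rewrite src_mul// => bc ->.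
by rewrite -mul_assoc//; apply: gprodP; rewrite ?rng_mul//; exact: gprodP.
Qed.

Lemma gprod_inj_src (C D : set G) :
  set_inj C s -> set_inj D s -> set_inj (gprod gr C D) s.
Proof.
move=> Ci Di _ _ /set_mem[a [b [Ca Db ab ->]]] /set_mem[a' [b' [Ca' Db' ab' ->]]].
rewrite !src_mul// => bb'.
have eb : b = b' by apply: Di; rewrite ?inE.
have -> : a = a' by apply: Ci; rewrite ?inE// ab ab' eb.
by rewrite eb.
Qed.

End GroupoidAlgebra.

(** * Covers and separation in topological spaces *)

Section TopologyPreliminaries.

(* [compact_cover] needs a pointed type, hence the detour through
   [pointed_at]. *)
Lemma compact_nbhs_cover (T : topologicalType) (K : set T) (U : T -> set T) :
  compact K -> (forall x, K x -> nbhs x (U x)) ->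
  exists l : seq T, (forall x, x \in l -> K x) /\
    K `<=` [set y | exists2 x, x \in l & U x y].
Proof.
have [->|/set0P[x0 _]] := eqVneq K set0; first by exists [::]; split.
move=> cK KU.
have : compact (K : set (pointed_at x0)) by [].
rewrite compact_cover => /(_ _ K (fun x => (U x)°)) [].
- by move=> x Kx; exact: open_interior.
- by move=> x Kx; exists x => //; exact: KU.
move=> F FK cov; exists (finmap.enum_fset F); split.
  by move=> x xF; have := FK x xF; rewrite inE.
by move=> y /cov[x /= xF /interior_subset Uy]; exists x.
Qed.

Lemma open_nbhs_subset (T : topologicalType) (A : set T) :
  (forall x, A x -> exists U, [/\ open U, U x & U `<=` A]) -> open A.
Proof.
move=> AU; rewrite openE => x /AU[U [oU Ux UA]].
by apply: filterS UA _; exact: open_nbhs_nbhs.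
Qed.

Lemma open_preimage (T U : topologicalType) (f : T -> U) (A : set U) :
  continuous f -> open A -> open (f @^-1` A).
Proof. by move=> /continuousP; apply. Qed.

Lemma hausdorff_separate_seq (T : topologicalType) (l : seq T) : hausdorff_space T ->
  exists R : T -> set T, (forall a, a \in l -> open (R a) /\ R a a) /\
    (forall a b, a \in l -> b \in l -> a != b -> R a `&` R b = set0).
Proof.
rewrite open_hausdorff => hT.
have /choice[f fP] : forall p : T * T, exists AB : set T * set T, p.1 != p.2 ->
    [/\ open AB.1, open AB.2, AB.1 p.1, AB.2 p.2 & AB.1 `&` AB.2 = set0].
  move=> [a b] /=; have [ab|ab] := eqVneq a b; first by exists (set0, set0).
  have [[A B] /= [Aa Bb] [oA oB AB]] := hT a b ab.
  by exists (A, B) => _; split=> //; exact: set_mem.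
(* The choices made for [(a, b)] and [(b, a)] are unrelated, so [R a] uses both; disjointness from
   [R b] then comes from the pair [(a, b)] alone. *)
pose R a := \big[setI/setT]_(b <- l | a != b) ((f (a, b)).1 `&` (f (b, a)).2).
exists R; split=> [a al|a b al bl ab].
  rewrite /R; elim/big_ind : _ => [||b ab].
  - by split; first exact: openT.
  - by move=> A B [oA Aa] [oB Ba]; split; [exact: openI|].
  - have ba : b != a by rewrite eq_sym.
    have [? _ ? _ _] := fP (a, b) ab; have [_ ? _ ? _] := fP (b, a) ba.
    by split; [exact: openI|].
rewrite -subset0 => x [Ra Rb].
have [_ _ _ _ <-] := fP (a, b) ab; split.
  by move: Ra; rewrite /R (big_rem b)//= ab => -[[]].
by move: Rb; rewrite /R (big_rem a)//= eq_sym ab => -[[]].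
Qed.

(** By induction on [l]: each member of the previous cover is cut into its intersection with [U i]
    and its difference with [K i], which still cover because [K i] lies in [U i]. *)
Lemma separating_cover (T : topologicalType) (I : eqType) (l : seq I)
    (U K : I -> set T) :
  (forall i, i \in l -> [/\ open (U i), closed (K i) & K i `<=` U i]) ->
  exists V : set (set T), [/\ finite_set V, forall W, V W -> open W,
    \bigcup_(W in V) W = setT &
    forall W i, V W -> i \in l -> W `<=` U i \/ W `&` K i = set0].
Proof.
elim: l => [|i l IH] lP.
  exists [set setT]; split=> //; first by move=> _ ->; exact: openT.
  by rewrite bigcup_set1.
have [j jl|V [finV oV covV sepV]] := IH.
  by apply: lP; rewrite inE jl orbT.
have [oU clK KU] := lP i (mem_head _ _).
exists ([set W `&` U i | W in V] `|` [set W `\` K i | W in V]); split.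
- by rewrite finite_setU; split; exact: finite_image.
- move=> _ [[W VW <-]|[W VW <-]]; first by apply: openI => //; exact: oV.
  by rewrite setDE; apply: openI; [exact: oV|exact: closed_openC].
- apply/seteqP; split=> // x _.
  have : (\bigcup_(W in V) W) x by rewrite covV.
  move=> [W VW Wx]; have [Kx|nKx] := pselect (K i x).
    by exists (W `&` U i); [left; exists W|split=> //; exact: KU].
  by exists (W `\` K i); [right; exists W|].
- move=> _ j [[W VW <-]|[W VW <-]]; rewrite inE => /orP[/eqP ->|jl].
  + by left; exact: subIsetr.
  + have [WU|WK] := sepV W j VW jl; first by left=> x [/WU].
    by right; rewrite setIAC WK set0I.
  + by right; rewrite -subset0 => x [[_ nKx] Kx]; exact: nKx.
  + have [WU|WK] := sepV W j VW jl; first by left=> x [/WU].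
    by right; rewrite -subset0 => x [[Wx _] Kx]; rewrite -WK.
Qed.

End TopologyPreliminaries.

(** * Open bisections and set products in an étale groupoid *)

Section TopologicalGroupoid.
Variables (X G : topologicalType) (gr : groupoid X G).
Hypotheses (top_gr : topological_groupoid gr) (etale_gr : etale gr).
Hypothesis hausdorffG : hausdorff_space G.
Hypothesis locally_compactG : locally_compact [set: G].
Local Notation s := (src gr).
Local Notation r := (rng gr).
Local Notation e := (gunit gr).
Local Notation mul := (gmul gr).
Local Notation inv := (ginv gr).

(** The quotient [mul (inv g) h] is an isotropy arrow at [x], hence the unit. *)
Lemma trivial_isotropy_inj x g h : trivial_isotropy gr x ->
  s g = x -> s h = x -> r g = r h -> g = h.
Proof.
move=> tx gx hx gh; apply/esym; apply: (@gmulgI _ _ gr (inv g)).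
- by rewrite src_inv.
- by rewrite src_inv.
have : [set g | s g = x /\ r g = x] (mul (inv g) h).
  by split; rewrite ?src_mul ?rng_mul ?rng_inv ?src_inv.
by rewrite tx => ->; rewrite mul_invl gx.
Qed.

Lemma src_cts : continuous s. Proof. by case: top_gr. Qed.
Lemma rng_cts : continuous r. Proof. by case: top_gr. Qed.
Lemma gunit_cts : continuous e. Proof. by case: top_gr. Qed.
Lemma ginv_cts : continuous inv. Proof. by case: top_gr. Qed.

Lemma hausdorff_units : hausdorff_space X.
Proof.
rewrite open_hausdorff => x y xy.
have exy : e x != e y by apply: contra_neq xy; exact: gunit_inj.
move: hausdorffG; rewrite open_hausdorff => /(_ _ _ exy)[[A B] /= [xA yB]].
move=> [oA oB AB]; exists (e @^-1` A, e @^-1` B) => /=.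
  by move: xA yB; rewrite !inE.
split; try exact: open_preimage gunit_cts _.
by apply/eqP; rewrite -preimage_setI (eqP AB) preimage_set0.
Qed.

Lemma open_ginv A : open A -> open (inv @` A).
Proof. by rewrite image_ginv; apply: open_preimage; exact: ginv_cts. Qed.

(** Near [r g] the local inverse [f] of [r] is continuous, and points whose [f]-value lies in [A]
    are ranges of arrows of [A]. *)
Lemma open_rng A : open A -> open (r @` A).
Proof.
move=> oA; apply: open_nbhs_subset => _ [g Ag <-].
have [U [oU Ug orU [_ _ [f [fK]]]]] := etale_gr g.
rewrite continuous_open_subspace// continuous_inP// => fcts.
exists (r @` U `&` f @^-1` A); split; first exact: fcts.
- by split; [exists g|rewrite /= fK].
- by move=> _ [[u Uu <-]] /=; rewrite fK// => Au; exists u.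
Qed.

Lemma open_src A : open A -> open (s @` A).
Proof.
move=> oA; rewrite (_ : s @` A = r @` (inv @` A)); last first.
  apply/seteqP; split=> [_ [g Ag <-]|_ [_ [g Ag <-] <-]].
    by exists (inv g); [exists g|rewrite rng_inv].
  by exists g; rewrite ?rng_inv.
by apply: open_rng; exact: open_ginv.
Qed.

(** The étale condition concerns [r] only; injectivity of [s] near [g] is that of [r] near
    [inv g]. *)
Lemma bisection_basis g A : open A -> A g ->
  exists U, [/\ open U, U g, U `<=` A, set_inj U s & set_inj U r].
Proof.
move=> oA Ag.
have rinj h : exists U, [/\ open U, U h & set_inj U r].
  by have [U [oU Uh _ [[_ +] _ _]]] := etale_gr h; exists U.
have [U [oU Ug Ui]] := rinj g; have [V [oV Vg Vi]] := rinj (inv g).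
exists (A `&` (U `&` inv @^-1` V)); split.
- by do 2 apply: openI => //; apply: open_preimage => //; exact: ginv_cts.
- by split.
- exact: subIsetl.
- move=> h k /set_mem[_ [_ /= Vh]] /set_mem[_ [_ /= Vk]] hk.
  apply: (can_inj (ginvK gr)); apply: Vi; rewrite ?inE//.
  by rewrite !rng_inv.
- move=> h k /set_mem[_ [Uh _]] /set_mem[_ [Uk _]] hk.
  by apply: Ui; rewrite ?inE.
Qed.

(** An arrow [g] close to a unit lies together with [e (s g)] in a set where [s] is injective, and
    so equals it. *)
Lemma open_units : open (range e).
Proof.
apply: open_nbhs_subset => _ [x _ <-].
have [U [oU Ux _ Ui _]] := bisection_basis openT (I : setT (e x)).
exists (U `&` (e \o s) @^-1` U); split.
- apply: openI => //; apply: open_preimage => // g.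
  by apply: continuous_comp; [exact: src_cts|exact: gunit_cts].
- by split=> //=; rewrite src_unit.
- move=> g [Ug /= Ueg]; exists (s g) => //; apply: Ui; rewrite ?inE//.
  by rewrite src_unit.
Qed.

Lemma open_gunit W : open W -> open (e @` W).
Proof.
move=> oW; rewrite (_ : e @` W = range e `&` s @^-1` W).
  by apply: openI; [exact: open_units|exact: open_preimage src_cts _].
apply/seteqP; split=> [_ [x Wx <-]|_ [[x _ <-]]] /=.
  by rewrite src_unit; split => //; exists x.
by rewrite src_unit => Wx; exists x.
Qed.

(* The inverse of an injective restriction of the open map [s]. *)
Lemma section_cts A : open A -> set_inj A s ->
  exists f : X -> G, (forall g, A g -> f (s g) = g) /\
    (forall g, A g -> f @ s g --> g).
Proof.
move=> oA Ai.
have /choice[f fP] : forall x, exists g,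
    (exists2 h, A h & s h = x) -> A g /\ s g = x.
  move=> x; have [[h Ah hx]|nx] := pselect (exists2 h, A h & s h = x).
    by exists h.
  by exists (e x).
have fK g : A g -> f (s g) = g.
  move=> Ag; have [] := fP (s g); first by exists g.
  by move=> Af sf; apply: Ai; rewrite ?inE.
exists f; split=> // g Ag V; rewrite nbhsE => -[W [oW Wg] WV].
have : nbhs (s g) (s @` (W `&` A)).
  apply: open_nbhs_nbhs; split; first by apply: open_src; exact: openI.
  by exists g.
by apply: filterS => _ [h [Wh Ah] <-] /=; rewrite fK//; exact: WV.
Qed.

Lemma open_s_section_inj A : open A -> set_inj A s -> open_s_section gr A.
Proof.
move=> oA Ai; split=> //; first exact: open_src.
split; first by split=> // g Ag; apply: imageP.
  exact: continuous_subspaceT src_cts.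
have [f [fK fcts]] := section_cts oA Ai; exists f; split => //.
apply: continuous_in_subspaceT => _ /set_mem[g Ag <-].
by rewrite /prop_for /continuous_at fK//; exact: fcts.
Qed.

Lemma open_r_section_inj A : open A -> set_inj A r -> open_r_section gr A.
Proof.
move=> oA Ai; split=> //; first exact: open_rng.
split; first by split=> // g Ag; apply: imageP.
  exact: continuous_subspaceT rng_cts.
have oA' := open_ginv oA.
have Ai' : set_inj (inv @` A) s.
  move=> _ _ /set_mem[g Ag <-] /set_mem[h Ah <-]; rewrite !src_inv => gh.
  by congr inv; apply: Ai; rewrite ?inE.
have [f [fK fcts]] := section_cts oA' Ai'; exists (inv \o f); split => /=.
  by move=> g Ag; rewrite -src_inv fK ?ginvK//; exists g.
apply: continuous_in_subspaceT => _ /set_mem[g Ag <-].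
rewrite /prop_for; apply: continuous_comp; last exact: ginv_cts.
have iAg : (inv @` A) (inv g) by exists g.
by rewrite /prop_for /continuous_at -(src_inv gr g) fK//; exact: fcts.
Qed.

Lemma open_bisection_inj A : open A -> set_inj A s -> set_inj A r ->
  open_bisection gr A.
Proof.
by move=> oA sA rA; split; [exact: open_s_section_inj|exact: open_r_section_inj].
Qed.

Lemma gmul_cvg (I : Type) (F : set_system I) {FF : Filter F} (f g : I -> G) a b :
  s a = r b -> f @ F --> a -> g @ F --> b ->
  (\forall i \near F, s (f i) = r (g i)) ->
  (fun i => mul (f i) (g i)) @ F --> mul a b.
Proof.
move=> ab fa gb fg; have [_ _ _ _ /subspace_continuousP/(_ (a, b) ab)] := top_gr.
apply: cvg_trans; move=> V /=; rewrite nbhs_simpl /= => -[[A B] /= [nA nB] AB].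
have : F (f @^-1` A) by apply: fa.
have : F (g @^-1` B) by apply: gb.
move: fg; rewrite !near_simpl; apply: filterS3 => i fgi Bi Ai.
exact: (AB (f i, g i)).
Qed.

(** Dividing [g] near [mul a b] by the value at [s g] of a local section of [s] through [b] gives an
    arrow near [a], hence in [A]. *)
Lemma gprod_open A B : open A -> open B -> open (gprod gr A B).
Proof.
move=> oA oB; apply: open_nbhs_subset => _ [a [b [Aa Bb ab ->]]].
have [U [oU Ub UB Ui _]] := bisection_basis oB Bb.
have [f [fK fcts]] := section_cts oU Ui.
pose h := fun g => mul g (inv (f (s g))).
have hab : h @ mul a b --> a.
  rewrite -[X in _ --> X](gmulgK ab); apply: gmul_cvg.
  - by rewrite rng_inv src_mul.
  - exact: cvg_id.
  - apply: (@cvg_comp _ _ _ (f \o s) inv _ (nbhs b)); last exact: ginv_cts.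
    apply: (@cvg_comp _ _ _ s f _ (nbhs (s b))); last exact: fcts.
    by rewrite -(src_mul ab); exact: src_cts.
  - have : nbhs (mul a b) (s @^-1` (s @` U)).
      apply: open_nbhs_nbhs; split; last by rewrite /= src_mul//; exists b.
      by apply: open_preimage src_cts _; exact: open_src.
    by apply: filterS => g [u Uu us]; rewrite -us fK// rng_inv.
have : nbhs (mul a b) (h @^-1` A `&` s @^-1` (s @` U)).
  apply: filterI; first by apply: hab; exact: open_nbhs_nbhs.
  apply: open_nbhs_nbhs; split; last by rewrite /= src_mul//; exists b.
  by apply: open_preimage src_cts _; exact: open_src.
rewrite nbhsE => -[W [oW Wab] WA]; exists W; split=> // g /WA[/= Ah [u Uu us]].
have fu : f (s g) = u by rewrite -us fK.
exists (h g), u; split=> //; first exact: UB.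
  by rewrite /h fu src_mul ?rng_inv// src_inv.
by rewrite /h fu gmulgVK.
Qed.

Lemma gprod_compact A B : compact A -> compact B -> compact (gprod gr A B).
Proof.
move=> cA cB.
have -> : gprod gr A B = (fun p : G * G => mul p.1 p.2) @`
    ((A `*` B) `&` [set p | s p.1 = r p.2]).
  apply/seteqP; split=> [_ [a [b [Aa Bb ab ->]]]|_ [[a b] [[/= Aa Bb] ab] <-]].
    by exists (a, b).
  exact: gprodP.
apply: continuous_compact.
  have [_ _ _ _] := top_gr; apply: continuous_subspaceW.
  exact: subIsetr.
apply: compact_closedI; first exact: compact_setX.
(* Composable pairs form a closed set because the unit space is Hausdorff. *)
rewrite -openC; apply: open_nbhs_subset => -[a b] /= /eqP ab.
move: hausdorff_units; rewrite open_hausdorff => /(_ _ _ ab)[[U V] /=].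
rewrite !inE => -[Ua Vb] [oU oV UV].
exists ((s \o fst) @^-1` U `&` (r \o snd) @^-1` V); split=> //.
  apply: openI; apply: open_preimage => // p; apply: continuous_comp.
  - exact: cvg_fst.
  - exact: src_cts.
  - exact: cvg_snd.
  - exact: rng_cts.
move=> [g h] [/= Ug Vh] gh; suff : set0 (s g) by [].
by rewrite -UV; split=> //; rewrite gh.
Qed.

Lemma compact_nbhs_in (A : set G) g : open A -> A g ->
  exists K, [/\ compact K, nbhs g K & K `<=` A].
Proof.
move=> oA Ag; have := locally_compactG (I : setT g).
case=> V; rewrite withinET => nV [cV clV].
have VA : nbhs g (V `&` A) by apply: filterI => //; exact: open_nbhs_nbhs.
have [B nB BVA] := compact_regular hausdorffG cV nV VA.
exists (closure B); split.
- apply: (subclosed_compact _ cV); first exact: closed_closure.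
  by move=> x /BVA[].
- by apply: filterS nB; exact: subset_closure.
- by move=> x /BVA[].
Qed.

Lemma precompact_bisection_basis g (A : set G) : open A -> A g ->
  exists U K, [/\ open U, U g, U `<=` K, compact K & K `<=` A] /\
    [/\ set_inj U s & set_inj U r].
Proof.
move=> oA Ag; have [K [cK nK KA]] := compact_nbhs_in oA Ag.
have [|U [oU Ug UK Us Ur]] := bisection_basis (open_interior K) (g := g).
  exact: nK.
exists U, K; split => //; split => //.
by apply: subset_trans UK _; exact: interior_subset.
Qed.

End TopologicalGroupoid.

(** * From finitely additive to Borel probabilities *)

Section ContentExtension.
Local Open Scope ereal_scope.
Variables (R : realType) (X : topologicalType).
Hypotheses (hausdorffX : hausdorff_space X) (compactX : compact [set: X]).
Variable m : set X -> R.
Hypotheses (m_ge0 : forall A, (0 <= m A)%R)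
  (mU : forall A B, A `&` B = set0 -> m (A `|` B) = (m A + m B)%R).

Let closedD (T : topologicalType) (A B : set T) :
  closed A -> open B -> closed (A `\` B).
Proof. by move=> clA oB; rewrite setDE; apply: closedI => //; exact: open_closedC. Qed.

Lemma content_le A B : A `<=` B -> (m A <= m B)%R.
Proof.
by move=> AB; rewrite -(setDUK AB) mU ?setDIK// lerDl.
Qed.

Lemma contentU_le A B : (m (A `|` B) <= m A + m B)%R.
Proof.
have -> : A `|` B = A `|` (B `\` A) by rewrite setUDr setDv setD0.
by rewrite mU ?setDIK// lerD2l content_le//; exact: subDsetl.
Qed.

(* As in the Riesz-Markov theorem, [m] is regularised first from the inside by
   closed sets and then from the outside by open sets; open sets are then
   Caratheodory measurable, even when [X] is not metrizable. *)
Definition inner_content (U : set X) : \bar R :=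
  ereal_sup [set (m C)%:E | C in [set C | closed C /\ C `<=` U]].

Lemma inner_content_ub C U : closed C -> C `<=` U ->
  (m C)%:E <= inner_content U.
Proof. by move=> clC CU; apply: ereal_sup_ubound; exists C. Qed.

Lemma inner_content_ge0 U : 0 <= inner_content U.
Proof.
apply: le_trans (inner_content_ub closed0 (sub0set U)).
by rewrite lee_fin.
Qed.

Lemma inner_content_le_total U : inner_content U <= (m setT)%:E.
Proof.
by apply: ge_ereal_sup => _ [C _ <-]; rewrite lee_fin content_le.
Qed.

Lemma inner_content_fin U : inner_content U \is a fin_num.
Proof.
rewrite ge0_fin_numE ?inner_content_ge0//.
by apply: le_lt_trans (inner_content_le_total U) _; rewrite ltry.
Qed.

Lemma inner_content_mono U V : U `<=` V -> inner_content U <= inner_content V.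
Proof.
move=> UV; apply: ge_ereal_sup => _ [C [clC CU] <-].
by apply: inner_content_ub => //; exact: subset_trans UV.
Qed.

Lemma inner_content_adherent U (d : R) : (0 < d)%R ->
  exists C, [/\ closed C, C `<=` U & inner_content U <= (m C)%:E + d%:E].
Proof.
move=> d0; have [_ [C [clC CU] <-] /ltW Cd] :=
  ub_ereal_sup_adherent d0 (inner_content_fin U).
by exists C; split=> //; rewrite -leeBlDr.
Qed.

Lemma content_sub_bigcup (U : nat -> set X) n C : (forall i, open (U i)) ->
  closed C -> C `<=` \bigcup_(i < n) U i ->
  (m C)%:E <= \sum_(i < n) inner_content (U i).
Proof.
move=> oU; elim: n C => [|n IH] C clC CU.
  rewrite big_ord0 (_ : C = set0); last by rewrite -subset0 => x /CU[].
  rewrite lee_fin; have := mU (setI0 set0); rewrite setU0; lra.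
have normalX := compact_normal hausdorffX compactX.
pose V := \bigcup_(i < n) U i.
have oV : open V by apply: bigcup_open.
have clA : closed (C `\` U n) by apply: closedD.
have [|W0 WA clWV] := normalX _ clA V.
  apply/set_nbhsP; exists V; split=> // x [Cx nUx].
  have [i /= + Uix] := CU _ Cx; rewrite leq_eqVlt => /orP[/eqP[ein]|ilt].
    by rewrite -ein in nUx.
  by exists i.
have /set_nbhsP[W [oW AW WW0]] := WA.
have clC1 : closed (C `&` closure W0) by apply: closedI => //; exact: closed_closure.
have clC2 : closed (C `\` W) by apply: closedD.
have CE : C `<=` (C `&` closure W0) `|` (C `\` W).
  move=> x Cx; have [Wx|nWx] := pselect (W x); last by right.
  by left; split=> //; apply: subset_closure; exact: WW0.
apply: (@le_trans _ _ ((m (C `&` closure W0))%:E + (m (C `\` W))%:E)).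
  by rewrite -EFinD lee_fin; apply: le_trans (contentU_le _ _); exact: content_le.
rewrite big_ord_recr /=; apply: leeD.
  by apply: IH => // x [_ /clWV].
apply: inner_content_ub => // x [Cx nWx]; apply: contrapT => nUx.
by apply: nWx; apply: AW.
Qed.

(** A closed [C] in the union is compact, so finitely many [U i] cover it and the finite case
    applies. *)
Lemma inner_content_subadd (U : nat -> set X) : (forall i, open (U i)) ->
  inner_content (\bigcup_i U i) <= \sum_(i <oo) inner_content (U i).
Proof.
move=> oU; apply: ge_ereal_sup => _ [C [clC CU] <-].
have /choice[ix ixP] : forall x, exists i, C x -> U i x.
  move=> x; have [/CU[i _ Uix]|nCx] := pselect (C x); first by exists i.
  by exists 0%N.
have [|l [lC lcov]] := compact_nbhs_cover (K := C) (U := fun x => U (ix x))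
    (subclosed_compact clC compactX (@subsetT _ _)).
  by move=> x /ixP Ux; exact: open_nbhs_nbhs.
pose n := (\max_(x <- l) ix x).+1.
apply: (@le_trans _ _ (\sum_(i < n) inner_content (U i))).
  apply: content_sub_bigcup => // y /lcov[x xl Uxy]; exists (ix x) => //=.
  by rewrite /n ltnS; exact: leq_bigmax_seq.
rewrite -(big_mkord xpredT (fun i => inner_content (U i))).
by apply: nneseries_lim_ge => i _ _; exact: inner_content_ge0.
Qed.

Definition outer_content (E : set X) : \bar R :=
  ereal_inf [set inner_content U | U in [set U | open U /\ E `<=` U]].

Lemma outer_content_lb E U : open U -> E `<=` U ->
  outer_content E <= inner_content U.
Proof. by move=> oU EU; apply: ereal_inf_lbound; exists U. Qed.

Lemma outer_content_open U : open U -> outer_content U = inner_content U.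
Proof.
move=> oU; apply/eqP; rewrite eq_le outer_content_lb//=.
by apply: le_ereal_inf_tmp => _ [V [oV UV] <-]; exact: inner_content_mono.
Qed.

Lemma outer_content_ge0 E : 0 <= outer_content E.
Proof.
by apply: le_ereal_inf_tmp => _ [V _ <-]; exact: inner_content_ge0.
Qed.

Lemma outer_content0 : outer_content set0 = 0.
Proof.
rewrite outer_content_open; last exact: open0.
apply/eqP; rewrite eq_le inner_content_ge0 andbT.
apply: ge_ereal_sup => _ [C [clC CU] <-].
rewrite (_ : C = set0); last by rewrite -subset0.
by rewrite lee_fin; have := mU (setI0 set0); rewrite setU0; lra.
Qed.

Lemma outer_content_mono E F : E `<=` F -> outer_content E <= outer_content F.
Proof.
move=> EF; apply: le_ereal_inf_tmp => _ [V [oV FV] <-].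
by apply: outer_content_lb => //; exact: subset_trans FV.
Qed.

Lemma outer_content_fin E : outer_content E \is a fin_num.
Proof.
rewrite ge0_fin_numE ?outer_content_ge0//.
apply: (@le_lt_trans _ _ (inner_content setT)).
  by apply: outer_content_lb => //; exact: openT.
by have := inner_content_fin setT; rewrite ge0_fin_numE ?inner_content_ge0.
Qed.

Lemma outer_content_adherent E (d : R) : (0 < d)%R ->
  exists U, [/\ open U, E `<=` U & inner_content U <= outer_content E + d%:E].
Proof.
move=> d0; have [_ [U [oU EU] <-] /ltW Ud] :=
  lb_ereal_inf_adherent d0 (outer_content_fin E).
by exists U.
Qed.

Lemma outer_content_sigma_subadditive : sigma_subadditive outer_content.
Proof.
move=> F; apply/lee_addgt0Pr => d d0.
have /choice[U UP] : forall i, exists U, [/\ open U, F i `<=` U &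
    inner_content U <= outer_content (F i) + (d / (2 ^ i.+1)%:R)%:E].
  by move=> i; apply: outer_content_adherent; rewrite divr_gt0// ltr0n expn_gt0.
apply: (@le_trans _ _ (inner_content (\bigcup_i U i))).
  apply: outer_content_lb; first by apply: bigcup_open => i _; case: (UP i).
  by move=> x [i _ Fx]; exists i => //; case: (UP i) => _ + _; exact.
apply: le_trans (inner_content_subadd _) _; first by move=> i; case: (UP i).
apply: le_trans (epsilon_trick xpredT _ _); last first.
- exact: ltW.
- by move=> i; exact: outer_content_ge0.
by apply: lee_nneseries => i _ *; [exact: inner_content_ge0|case: (UP i)].
Qed.

(** Inside an open [V] containing [E], the intersection with [U] is almost exhausted by a closed
    [C], then [V] minus [C] by a closed [F]. Being disjoint, [C] and [F] have total content at most
    that of [V], and [V] minus [C] still contains [E] minus [U]. *)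
Lemma open_caratheodory U : open U -> forall E,
  outer_content (E `&` U) + outer_content (E `&` ~` U) <= outer_content E.
Proof.
move=> oU E; apply: le_ereal_inf_tmp => _ [V [oV EV] <-].
apply/lee_addgt0Pr => d d0.
have d20 : (0 < d / 2)%R by rewrite divr_gt0.
have [C [clC CV Cd]] := inner_content_adherent (V `&` U) d20.
have [F [clF FV Fd]] := inner_content_adherent (V `\` C) d20.
have CDV : (m C)%:E + (m F)%:E <= inner_content V.
  rewrite -EFinD -mU; last first.
    by rewrite -subset0 => x [Cx /FV[]].
  apply: inner_content_ub; first exact: closedU.
  by move=> x [/CV[]|/FV[]].
have EU : outer_content (E `&` U) <= inner_content (V `&` U).
  by apply: outer_content_lb; [exact: openI|exact: setSI].
have ED : outer_content (E `&` ~` U) <= inner_content (V `\` C).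
  apply: outer_content_lb; first by
    rewrite setDE; apply: openI => //; exact: closed_openC.
  by move=> x [/EV Vx nUx]; split=> // /CV[].
have fin := inner_content_fin; have ofin := outer_content_fin.
move: EU ED Cd Fd CDV.
rewrite -(fineK (ofin (E `&` U))) -(fineK (ofin (E `&` ~` U))).
rewrite -(fineK (fin V)) -(fineK (fin (V `&` U))) -(fineK (fin (V `\` C))).
rewrite -!EFinD !lee_fin; lra.
Qed.

Lemma content_probability (x0 : X) : m setT = 1%R ->
  exists P : probability (borel_type x0) R,
    forall U : set X, open U -> P U = inner_content U.
Proof.
move=> mT.
pose OM : outer_measure R (pointed_at x0) :=
  HB.pack (outer_content : set (pointed_at x0) -> \bar R)
    (isOuterMeasure.Build R (pointed_at x0) outer_content outer_content0
      outer_content_ge0 outer_content_mono outer_content_sigma_subadditive).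
pose B := borel_type x0.
have mB (A : set B) : measurable A -> OM.-caratheodory A.
  (* Borel sets lie in every sigma-algebra containing the open sets, here that of the Caratheodory
     measurable sets. *)
  move=> mA; apply: mA; split.
    split.
    - exact: (caratheodory_measurable_set0 OM).
    - move=> C mC; rewrite setTD; exact: (caratheodory_measurable_setC mC).
    - move=> F; exact: (caratheodory_measurable_bigcup (mu := OM)).
  move=> U oU; apply: (le_caratheodory_measurable (mu := OM)).
  exact: open_caratheodory oU.
have sadd : semi_sigma_additive (outer_content : set B -> \bar R).
  move=> F mF tF mUF.
  exact: (@caratheodory_measure_sigma_additive R (pointed_at x0) OM F
    (fun i => mB _ (mF i)) tF (mB _ mUF)).
pose M : measure B R :=
  HB.pack (outer_content : set B -> \bar R)
    (isMeasure.Build _ B R outer_content outer_content0 outer_content_ge0 sadd).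
have MT : M setT = 1.
  rewrite /M /= outer_content_open; last exact: openT.
  apply/eqP; rewrite eq_le -{1}mT inner_content_le_total -mT.
  exact: inner_content_ub closedT _.
pose P : probability B R :=
  HB.pack (Measure.sort M) (Measure_isProbability.Build _ _ _ M MT).
by exists P => U oU; rewrite /= outer_content_open.
Qed.

End ContentExtension.

(** * Folner sets and invariant probabilities *)

Section Folner.
Variables (X G : topologicalType) (gr : groupoid X G).
Local Notation s := (src gr).
Local Notation r := (rng gr).
Local Notation e := (gunit gr).
Local Notation mul := (gmul gr).
Local Notation inv := (ginv gr).

(* [|K F| >= (a / b) |F|], phrased with finite subsets [E] of [K F] so that the
   finiteness of [K F] need not be known. *)
Definition expands (K : set G) (a b : nat) := forall F : seq G, uniq F ->
  exists E : seq G, [/\ uniq E, (forall x, x \in E -> gprod gr K [set` F] x) &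
    (a * size F <= b * size E)%N].

(** These are the finite sets at which expansion by the factor [(n + 2) / (n + 1)] fails. *)
Definition folner (K : set G) (n : nat) (F : seq G) := [/\ uniq F, F != [::] &
  forall E : seq G, uniq E -> (forall x, x \in E -> gprod gr K [set` F] x) ->
    (n.+1 * size E < n.+2 * size F)%N].

Lemma not_expands_folner K n : ~ expands K n.+2 n.+1 -> exists F, folner K n F.
Proof.
move=> /existsNP[F /not_implyP[uF nE]]; exists F; split=> //.
  by apply/eqP => F0; apply: nE; exists [::]; rewrite F0.
move=> E uE EF; rewrite ltnNge; apply/negP => le.
by apply: nE; exists E.
Qed.

Definition hits (B : set X) (F : seq G) : nat := count (fun g => `[< B (r g) >]) F.

(* Translating by [C] sends the points of [F] lying over [s C] injectively to
   points over [r C], and only a small proportion of the images leaves [F]. *)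
Lemma folner_hits K n F C : folner K n F -> range e `<=` K -> C `<=` K ->
  set_inj C s -> set_inj C r ->
  (n.+1 * hits (s @` C) F <= n.+1 * hits (r @` C) F + size F)%N.
Proof.
move=> [uF _ FE] eK CK Cs Cr.
have /choice[c cP] : forall x, exists g, (s @` C) x -> C g /\ s g = x.
  move=> x; have [[g Cg gx]|nx] := pselect ((s @` C) x); first by exists g.
  by exists (e x).
pose F1 := [seq g <- F | `[< (s @` C) (r g) >]].
pose phi g := mul (c (r g)) g.
have F1P g : g \in F1 -> [/\ g \in F, C (c (r g)) & s (c (r g)) = r g].
  rewrite mem_filter => /andP[/asboolP /cP[Cg sg] gF]; by split.
have phi_inj : {in F1 &, injective phi}.
  move=> g h /F1P[_ Cg cg] /F1P[_ Ch ch] gh.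
  have rgh : c (r g) = c (r h).
    apply: Cr; rewrite ?inE//.
    by move/(congr1 r): gh; rewrite !rng_mul.
  by apply: (gmulgI cg); rewrite ?rgh// -[in LHS]rgh.
pose L := map phi F1.
have uL : uniq L by rewrite map_inj_in_uniq// filter_uniq.
pose LF := [seq h <- L | h \in F]; pose LN := [seq h <- L | h \notin F].
have sL : size L = (size LF + size LN)%N.
  by rewrite !size_filter -(count_predC (mem F)).
have LFle : (size LF <= hits (r @` C) F)%N.
  rewrite /hits -size_filter; apply: uniq_leq_size; first exact: filter_uniq.
  move=> h; rewrite !mem_filter => /andP[hF /mapP[g /F1P[gF Cg cg] hg]].
  rewrite hF andbT; apply/asboolP; exists (c (r g)) => //.
  by rewrite hg rng_mul.
(* The Folner bound is applied to [F] together with the images that leave it, so that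
   [n.+1 * size LN < size F]. *)
have /FE/(_ _) : uniq (F ++ LN).
  rewrite cat_uniq uF filter_uniq// andbT -all_predC.
  by apply/allP => h; rewrite mem_filter => /andP[].
have sub : forall x, x \in F ++ LN -> gprod gr K [set` F] x.
  move=> x; rewrite mem_cat => /orP[xF|].
    rewrite -(mul_unitl gr x); apply: gprodP => //; last by rewrite src_unit.
    by apply: eK; exists (r x).
  rewrite mem_filter => /andP[_ /mapP[g /F1P[gF Cg cg] ->]].
  by apply: gprodP => //; exact: CK.
move=> /(_ sub); rewrite size_cat.
have -> : hits (s @` C) F = size L by rewrite size_map size_filter.
rewrite sL; move: LFle; rewrite -(leq_pmul2l (ltn0Sn n)).
move: (size LF) (size LN) (size F) (hits _ _) => a b f h.
by rewrite !mulnDr !mulSn; lia.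
Qed.

End Folner.

Section FolnerMeasure.
Variables (R : realType) (X G : topologicalType) (gr : groupoid X G).
Hypotheses (top_gr : topological_groupoid gr) (etale_gr : etale gr).
Hypothesis hausdorffG : hausdorff_space G.
Hypothesis compactX : compact [set: X].
Local Notation s := (src gr).
Local Notation r := (rng gr).
Local Notation e := (gunit gr).
Local Notation mul := (gmul gr).
Local Notation inv := (ginv gr).
Local Open Scope ring_scope.

(** The image ultrafilter contains a compact segment, so it has a cluster point, to which an
    ultrafilter must converge. *)
Lemma ultra_bounded_cvg (I : Type) (F : set_system I) (f : I -> R) (a b : R) :
  UltraFilter F -> (forall i, a <= f i <= b) -> cvg (f @ F).
Proof.
move=> UF fab; have PF := @ultra_proper _ _ UF.
have Fab : (f @ F) `[a, b]%classic.
  apply: (@filterS _ F _ setT); last exact: filterT.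
  by move=> i _; rewrite /= in_itv; exact: fab.
have [] := @segment_compact R a b (f @ F) _ Fab.
move=> p [_ pF]; apply/cvg_ex; exists p => V nV.
have [//|FnV] := in_ultra_setVsetC (f @^-1` V) UF.
by have [x [/= nVx Vx]] := pF (~` V) V FnV nV.
Qed.

Definition frequency (B : set X) (F : seq G) : R := (hits gr B F)%:R / (size F)%:R.

Lemma frequency_bounds B F : 0 <= frequency B F <= 1.
Proof.
rewrite /frequency divr_ge0//=; have [->|F0] := eqVneq (size F) 0%N.
  by rewrite invr0 mulr0.
by rewrite ler_pdivrMr ?ltr0n ?lt0n// mul1r ler_nat count_size.
Qed.

Lemma frequencyU A B F : A `&` B = set0 ->
  frequency (A `|` B) F = frequency A F + frequency B F.
Proof.
move=> AB; rewrite -mulrDl -natrD; congr (_%:R / _).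
rewrite /hits -count_predUI -[LHS]addn0; congr addn.
  by apply: eq_count => g /=; rewrite asbool_or.
apply/esym/eqP; rewrite -leqn0 leqNgt -has_count; apply/hasPn => g _ /=.
apply/negP => /andP[/asboolP Ag /asboolP Bg].
by have : (A `&` B) (r g) by []; rewrite AB.
Qed.

Lemma frequencyT F : F != [::] -> frequency setT F = 1.
Proof.
move=> F0; rewrite /frequency /hits (eq_count (a2 := predT)); last first.
  by move=> g; apply/asboolP.
by rewrite count_predT divff// pnatr_eq0 size_eq0.
Qed.

Lemma folner_frequency K n F C : folner gr K n F -> range e `<=` K -> C `<=` K ->
  set_inj C s -> set_inj C r ->
  frequency (s @` C) F <= frequency (r @` C) F + n.+1%:R^-1.
Proof.
move=> FF eK CK Cs Cr; have := folner_hits FF eK CK Cs Cr.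
case: FF => _ F0 _; rewrite -(ler_nat R) natrD !natrM => h.
have F0' : (size F)%:R != 0 :> R by rewrite pnatr_eq0 size_eq0.
rewrite -lerBlDl -mulrBl ler_pdivrMr ?lt0r ?F0' ?ler0n//.
rewrite -(ler_pM2l (x := n.+1%:R)) ?ltr0n// mulrA mulfV ?pnatr_eq0// mul1r.
lra.
Qed.

Lemma folner_invariant_probability :
  (forall K n, compact K -> exists F, folner gr K n F) ->
  invariant_probabilities R gr !=set0.
Proof.
move=> fol; pose I := (set G * nat)%type.
have /choice[F FP] : forall i : I, exists F, compact i.1 -> folner gr i.1 i.2 F.
  move=> [K n] /=; have [/(fol _ n)[F FF]|nK] := pselect (compact K).
    by exists F.
  by exists [::].
(* Pairs of a compact set and an integer are directed by inclusion and order; along an ultrafilter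
   finer than their tails, [frequency] converges for every set [B] at once. *)
pose base (i : I) := [set j : I | [/\ compact j.1, i.1 `<=` j.1 & (i.2 <= j.2)%N]].
pose tail := filter_from [set i : I | compact i.1] base.
have tailP : ProperFilter tail.
  apply: filter_from_proper; last by move=> i ci; exists i; split.
  apply: filter_from_filter; first by exists (set0, 0%N); exact: compact0.
  move=> [K n] [L k] /= cK cL; exists (K `|` L, maxn n k); first exact: compactU.
  move=> [M p] [/= cM KLM nkp]; split; split=> //=.
  - by apply: subset_trans KLM; exact: subsetUl.
  - by rewrite (leq_trans _ nkp)// leq_maxl.
  - by apply: subset_trans KLM; exact: subsetUr.
  - by rewrite (leq_trans _ nkp)// leq_maxr.
have [W [UW tailW]] := ultraFilterLemma tailP.
have PW := @ultra_proper _ _ UW.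
have Wbase i : compact i.1 -> W (base i) by move=> ci; apply: tailW; exists i.
have ne i : compact i.1 -> F i != [::] by move=> /FP[].
pose m (B : set X) : R := lim (frequency B (F i) @[i --> W]).
have mc B : frequency B (F i) @[i --> W] --> m B.
  by apply: ultra_bounded_cvg => i; exact: frequency_bounds.
have m_ge0 B : 0 <= m B.
  apply: limr_ge; first exact: mc.
  by apply: nearW => i; have /andP[] := frequency_bounds B (F i).
have mU A B : A `&` B = set0 -> m (A `|` B) = m A + m B.
  move=> AB; apply: (cvg_lim (@Rhausdorff R)).
  rewrite (_ : (fun i => _) = (fun i => frequency A (F i) + frequency B (F i))).
    by apply: cvgD; exact: mc.
  by apply/funext => i; rewrite frequencyU.
have mT : m setT = 1.
  apply: (cvg_lim (@Rhausdorff R)); apply: cvg_near_cst.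
  have := Wbase (set0, 0%N) (@compact0 _); apply: filterS => i [/ne Fi _ _].
  by rewrite frequencyT.
(* Far along the tails the Folner sets are adapted to compact sets containing [K] and the units, and
   the error [k.+1%:R^-1] drops below any [d]. *)
have m_le C K : compact K -> C `<=` K -> set_inj C s -> set_inj C r ->
    m (s @` C) <= m (r @` C).
  move=> cK CK Cs Cr; apply/ler_addgt0Pr => d d0.
  have [n nd] : exists n, n.+1%:R^-1 <= d :> R.
    have [n] := ltr_add_invr (d0 : 0 < d); rewrite add0r => nd.
    by exists n; exact: ltW.

  have cd : (frequency (r @` C) (F i) + d - frequency (s @` C) (F i)) @[i --> W]
      --> m (r @` C) + d - m (s @` C).
    by apply: cvgB; [apply: cvgD; [exact: mc|exact: cvg_cst]|exact: mc].
  rewrite -subr_ge0 -(cvg_lim (@Rhausdorff R) cd).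
  apply: limr_ge; first by apply/cvg_ex; eexists; exact: cd.
  have eK : compact (range e).
    by apply: continuous_compact => //; apply: continuous_subspaceT; exact: gunit_cts.
  have WKn := Wbase (K `|` range e, n) (compactU cK eK).
  apply: filterS WKn => -[L k] [/= cL KL nk]; rewrite subr_ge0.
  apply: (@le_trans _ _ (frequency (r @` C) (F (L, k)) + k.+1%:R^-1)).
    apply: (@folner_frequency L k) => //; first exact: (FP (L, k) cL).
    - by move=> x ex; apply: KL; right.
    - by move=> x Cx; apply: KL; left; exact: CK.
  by rewrite lerD2l (le_trans _ nd)// lef_pV2 ?posrE ?ltr0n// ler_nat.
have [x0] : exists x0 : X, True.
  have := ne (set0, 0%N) (@compact0 _); case: (F _) => [//|g l] _.
  by exists (r g).
move=> _; have hX := hausdorff_units top_gr hausdorffG.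
have [P PE] := content_probability hX compactX m_ge0 mU x0 mT.
(* An open bisection need not lie in a compact set, but the inner content only sees closed [D]
   inside its source; the continuous section over [D] has compact image, to which [m_le] applies. *)
have nu_le (U : set G) : open U -> set_inj U s -> set_inj U r ->
    (inner_content m (s @` U) <= inner_content m (r @` U))%E.
  move=> oU sU rU; apply: ge_ereal_sup => _ [D [clC CsU] <-].
  have [f [fK fcts]] := section_cts top_gr etale_gr oU sU.
  have cfC : compact (f @` D).
    apply: continuous_compact; last exact: subclosed_compact clC compactX _.
    apply: continuous_in_subspaceT => x /set_mem /CsU[g Ug <-].
    by rewrite /prop_for /continuous_at fK//; exact: fcts.
  have fCU : f @` D `<=` U by move=> _ [x /CsU[g Ug <-] <-]; rewrite fK.
  have sfC : s @` (f @` D) = D.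
    apply/seteqP; split=> [_ [_ [x Cx <-] <-]|x Cx].
      by have [g Ug gx] := CsU _ Cx; rewrite -gx fK// gx.
    exists (f x); first by exists x.
    by have [g Ug gx] := CsU _ Cx; rewrite -gx fK.
  have clrC : closed (r @` (f @` D)).
    apply: compact_closed => //; apply: continuous_compact => //.
    by apply: continuous_subspaceT; exact: rng_cts.
  rewrite -sfC; apply: le_trans (inner_content_ub m clrC (image_subset _ fCU)).
  rewrite lee_fin; apply: (m_le _ _ cfC) => //.
    by move=> g h /set_mem/fCU Ug /set_mem/fCU Uh; apply: sU; rewrite inE.
  by move=> g h /set_mem/fCU Ug /set_mem/fCU Uh; apply: rU; rewrite inE.
exists P; split; first by exists x0, P.
move=> U [[oU osU [[_ sU _] _ _]] [_ orU [[_ rU _] _ _]]].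
rewrite !PE//; apply/eqP; rewrite eq_le nu_le//=.
(* The reverse inequality is the same one for the inverse bisection. *)
have -> : s @` U = r @` (inv @` U).
  by rewrite image_comp; apply: eq_imagel => g _ /=; rewrite rng_inv.
have -> : r @` U = s @` (inv @` U).
  by rewrite image_comp; apply: eq_imagel => g _ /=; rewrite src_inv.
apply: nu_le; first exact: open_ginv.
  move=> _ _ /set_mem[g Ug <-] /set_mem[h Uh <-]; rewrite !src_inv => gh.
  by congr inv; apply: rU; rewrite ?inE.
move=> _ _ /set_mem[g Ug <-] /set_mem[h Uh <-]; rewrite !rng_inv => gh.
by congr inv; apply: sU; rewrite ?inE.
Qed.

End FolnerMeasure.

(** * Expansion *)

Section Expansion.
Variables (X G : topologicalType) (gr : groupoid X G).
Hypotheses (top_gr : topological_groupoid gr) (etale_gr : etale gr).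
Hypothesis hausdorffG : hausdorff_space G.
Hypothesis compactX : compact [set: X].
Local Notation s := (src gr).
Local Notation r := (rng gr).
Local Notation e := (gunit gr).
Local Notation mul := (gmul gr).
Local Notation inv := (ginv gr).

Lemma expands_gprod K L a b c d : expands gr K a b -> expands gr L c d ->
  expands gr (gprod gr K L) (a * c) (b * d).
Proof.
move=> eK eL F uF; have [E [uE EF sE]] := eL F uF.
have [E' [uE' EE' sE']] := eK E uE; exists E'; split=> //.
  move=> x /EE' KEx; rewrite -gprodA.
  by apply: gprodS KEx => // y; exact: EF.
have : (a * (c * size F) <= a * (d * size E))%N by rewrite leq_mul2l sE orbT.
have : (d * (a * size E) <= d * (b * size E'))%N by rewrite leq_mul2l sE' orbT.
by move: (size F) (size E) (size E') => f g h; nia.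
Qed.

Lemma expands_pow K n k : compact K -> expands gr K n.+2 n.+1 ->
  exists L, compact L /\ expands gr L (n.+2 ^ k) (n.+1 ^ k).
Proof.
move=> cK eK; elim: k => [|k [L [cL eL]]].
  exists (range e); split.
    by apply: continuous_compact => //; apply: continuous_subspaceT; exact: gunit_cts.
  move=> F uF; exists F; split=> // x xF; rewrite -(mul_unitl gr x).
  by apply: gprodP => //; rewrite src_unit.
exists (gprod gr K L); split; first exact: gprod_compact.
by rewrite !expnS; exact: expands_gprod.
Qed.

(** Bernoulli's inequality for [(1 + 1 / (n + 1)) ^ k], cleared of denominators. *)
Lemma bernoulli_expn n k : ((n.+1 + k) * n.+1 ^ k <= n.+1 * n.+2 ^ k)%N.
Proof.
elim: k => [|k IH]; first by rewrite !expn0 addn0.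
rewrite !expnS; move: (n.+1 ^ k) (n.+2 ^ k) IH => a b IH.
have : (n.+2 * ((n.+1 + k) * a) <= n.+2 * (n.+1 * b))%N by rewrite leq_mul2l IH orbT.
nia.
Qed.

Lemma expands_large K n M : compact K -> expands gr K n.+2 n.+1 ->
  exists L, compact L /\ expands gr L M 1.
Proof.
(* The exponent [M * n.+1] makes Bernoulli's lower bound equal to [M.+1]. *)
move=> cK eK; have [L [cL eL]] := expands_pow (M * n.+1) cK eK.
exists L; split=> // F /eL[E [uE EF sE]]; exists E; split=> //.
have := bernoulli_expn n (M * n.+1).
rewrite -mulSn -mulnA (mulnCA _ n.+1) leq_pmul2l// => Mab.
rewrite mul1n -(leq_pmul2l (_ : 0 < n.+1 ^ (M * n.+1))%N) ?expn_gt0//.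
apply: leq_trans sE; rewrite mulnA leq_mul2r; apply/orP; right.
apply: leq_trans Mab; rewrite mulnC leq_mul2r leqnSn orbT//.
Qed.

End Expansion.

(** * Moving arrows into an open set by minimality *)

Section Transport.
Variables (X G : topologicalType) (gr : groupoid X G).
Hypotheses (top_gr : topological_groupoid gr) (etale_gr : etale gr).
Hypothesis hausdorffG : hausdorff_space G.
Hypothesis locally_compactG : locally_compact [set: G].
Hypothesis compactX : compact [set: X].
Hypothesis minimal_gr : minimal gr.
Local Notation s := (src gr).
Local Notation r := (rng gr).
Local Notation e := (gunit gr).
Local Notation mul := (gmul gr).
Local Notation inv := (ginv gr).

(** The complement of the saturation is closed and invariant; it misses [O], so it is not all of
    [X], and minimality makes it empty. *)
Lemma saturation_setT O : open O -> O !=set0 -> saturation gr O = setT.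
Proof.
move=> oO [x Ox]; apply/seteqP; split=> // y _; apply: contrapT => ny.
have oS : open (saturation gr O).
  by apply: open_rng => //; apply: open_preimage oO; exact: src_cts.
have DT : ~` saturation gr O = setT.
  apply: minimal_gr; first exact: open_closedC.
  - apply/seteqP; split=> [_ [g /= nsg <-]|z nz].
      move=> [h /= Oh hg]; apply: nsg; exists (mul (inv g) h) => /=.
        by rewrite src_mul// src_inv.
      by rewrite rng_mul ?src_inv// rng_inv.
    by exists (e z); rewrite /= ?src_unit ?rng_unit.
  - by exists y.
have : (~` saturation gr O) x by rewrite DT.
by apply; exists (e x); rewrite /= ?src_unit ?rng_unit.
Qed.

(** By [saturation_setT], every point is the source of an arrow ending in [O]; compactness of [X]
    leaves finitely many bisections around such arrows. The compact [Q] serves to extend a castle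
    along all of them. *)
Lemma exists_bisection_cover O : open O -> O !=set0 ->
  exists (l : seq (set G)) (Q : set G), [/\ forall B, B \in l ->
      [/\ open B, set_inj B s, set_inj B r, r @` B `<=` O & B `<=` Q],
    compact Q & forall x, exists2 B, B \in l & (s @` B) x].
Proof.
move=> oO O0.
have /choice[B /choice[Q BQ]] : forall x, exists B Q, [/\ open B, (s @` B) x, B `<=` Q,
    compact Q & Q `<=` r @^-1` O] /\ [/\ set_inj B s & set_inj B r].
  move=> x; have : saturation gr O x by rewrite saturation_setT.
  move=> [g /= Og gx].
  have oA : open (r @^-1` O) by apply: open_preimage oO; exact: rng_cts.
  have [|U [K [[oU Ug UK cK KO] inj]]] :=
    precompact_bisection_basis top_gr etale_gr hausdorffG locally_compactG
      (g := inv g) oA.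
    by rewrite /= rng_inv.
  exists U, K; split=> //; split=> //.
  by exists (inv g); rewrite ?src_inv.
have [|l [_ lcov]] := compact_nbhs_cover (U := fun x => s @` B x) compactX.
  move=> x _; have [[oB Bx _ _ _] _] := BQ x.
  by apply: open_nbhs_nbhs; split=> //; exact: open_src.
exists (map B l), (\big[setU/set0]_(x <- l) Q x); split.
- move=> _ /mapP[x xl ->]; have [[oB _ BQx _ QO] [sB rB]] := BQ x; split=> //.
    by move=> _ [g /BQx/QO Og <-].
  by move=> g /BQx Qg; rewrite -bigcup_seq; exists x.
- by apply: bigsetU_compact => x _; have [[]] := BQ x.
- move=> x; have [//|y yl Byx] := lcov x; exists (B y) => //.
  exact: map_f.
Qed.

(* An arrow of [T] is the translate of at most one arrow by each bisection. *)
Lemma transported_size (l : seq (set G)) (E T : seq G) :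
  (forall B, B \in l -> set_inj B r) -> uniq E ->
  (forall g, g \in E -> exists B b, [/\ B \in l, B b, s b = r g & mul b g \in T]) ->
  (size E <= size l * size T)%N.
Proof.
move=> lr uE ET.
have /choice[c cP] : forall p : set G * G, exists b,
    (exists2 g, p.1 g & r g = r p.2) -> p.1 b /\ r b = r p.2.
  move=> p; have [[g pg gp]|np] := pselect (exists2 g, p.1 g & r g = r p.2).
    by exists g.
  by exists p.2.
rewrite -(size_allpairs (fun B h => mul (inv (c (B, h))) h)).
apply: uniq_leq_size => // g /ET[B [b [Bl Bb bg bgT]]].
apply/allpairsP; exists (B, mul b g) => /=; split=> //.
have [|/= Bc rc] := cP (B, mul b g); first by exists b; rewrite //= rng_mul.
rewrite (_ : c _ = b) ?gmulKg//; apply: (lr _ Bl); rewrite ?inE//.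
by rewrite rc rng_mul.
Qed.

(* If [O] is a single point [x], then the isotropy at [x] is trivial and every
   bisection of the cover has at most one arrow ending at [x], which bounds the
   number of arrows starting there and contradicts expansion. *)
Lemma open_subset_split (O : set X) : topologically_principal gr ->
  (forall M, exists L, compact L /\ expands gr L M 1) ->
  open O -> O !=set0 ->
  exists V1 V2, [/\ [/\ open V1, V1 !=set0 & V1 `<=` O],
    [/\ open V2, V2 !=set0 & V2 `<=` O] & V1 `&` V2 = set0].
Proof.
move=> principal_gr exps oO [x Ox].
have [[y Oy xy]|nO] := pselect (exists2 y, O y & x != y).
  move: (hausdorff_units top_gr hausdorffG); rewrite open_hausdorff.
  move=> /(_ _ _ xy)[[U V] /= [xU yV] [oU oV /eqP UV]].
  exists (U `&` O), (V `&` O); split.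
  - by split; [exact: openI|exists x; split=> //; exact: set_mem|exact: subIsetr].
  - by split; [exact: openI|exists y; split=> //; exact: set_mem|exact: subIsetr].
  - by rewrite setIACA UV set0I.
have Ox1 y : O y -> y = x.
  by move=> Oy; apply: contrapT => /eqP; rewrite eq_sym => ?; apply: nO; exists y.
have tx : trivial_isotropy gr x.
  have [y [/= Oy ty]] := principal_gr O (ex_intro _ x Ox) oO.
  by rewrite -(Ox1 y).
have [l [Q [lP _ lcov]]] := exists_bisection_cover oO (ex_intro _ x Ox).
have [L [_ eL]] := exps (size l).+1.
have [E [uE EF]] := eL [:: e x] isT.
suff : (size E <= size l * 1)%N by rewrite /= !mul1n !muln1; lia.
apply: (@transported_size l E [:: e x]) => //.
  by move=> B /lP[].
move=> g /EF[k [h [Lk /=]]]; rewrite inE => /eqP -> kx ->.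
rewrite rng_unit in kx; rewrite -kx mul_unitr.
have [B Bl [b Bb bk]] := lcov (r k); exists B, b; split=> //.
rewrite inE; apply/eqP; apply: (trivial_isotropy_inj tx).
- by rewrite src_mul.
- by rewrite src_unit.
- rewrite rng_mul// rng_unit kx; apply: Ox1; have [_ _ _ + _] := lP _ Bl.
  by apply; exists b.
Qed.

End Transport.

(** * Ranks among the integers satisfying a predicate *)

Lemma count_iota_surj (p : pred nat) (N k : nat) : (k < count p (iota 0 N))%N ->
  exists t, [/\ (t < N)%N, p t & count p (iota 0 t) = k].
Proof.
elim: N => [//|N IH]; rewrite -{1}[N.+1]addn1 iotaD count_cat /= add0n addn0 => kN.
have [/IH[t [tN pt tk]]|Nk] := ltnP k (count p (iota 0 N)).
  by exists t; rewrite ltnS ltnW.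
by exists N; move: kN; case: (p N) => /= kN; split=> //; lia.
Qed.

Lemma count_iota_lt (p : pred nat) (t u : nat) : p t -> (t < u)%N ->
  (count p (iota 0 t) < count p (iota 0 u))%N.
Proof.
move=> pt tu; rewrite -(subnKC tu) iotaD count_cat -[t.+1]addn1 iotaD count_cat.
by rewrite /= add0n pt; lia.
Qed.

Lemma count_iota_inj (p : pred nat) (t u : nat) : p t -> p u ->
  count p (iota 0 t) = count p (iota 0 u) -> t = u.
Proof.
move=> pt pu tu; case: (ltngtP t u) => // [/(count_iota_lt pt)|/(count_iota_lt pu)];
  by rewrite tu ltnn.
Qed.

(** * Castles *)

Section CastleAlgebra.
Variables (X G : Type) (gr : groupoid X G) (D : set (set G)).
Hypothesis castleD : castle gr D.
Local Notation s := (src gr).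
Local Notation r := (rng gr).
Local Notation e := (gunit gr).
Local Notation mul := (gmul gr).
Local Notation inv := (ginv gr).
Local Notation H := (\bigcup_(E in D) E).

Lemma castle_mem_eq A B g : D A -> D B -> A g -> B g -> A = B.
Proof.
by move=> DA DB Ag Bg; have [[_ tD _ _ _] _] := castleD; apply: tD => //; exists g.
Qed.

Lemma castle_rng_units A : D A -> D (rng_units gr A).
Proof. by have [[_ _ _ clD _] _] := castleD => /clD[]. Qed.

Lemma castle_src_units A : D A -> D (src_units gr A).
Proof. by have [[_ _ _ clD _] _] := castleD => /clD[]. Qed.

Lemma castle_ginv A : D A -> D (inv @` A).
Proof. by have [[_ _ _ clD _] _] := castleD => /clD[]. Qed.

Lemma castle_gprod A B g h : D A -> D B -> A g -> B h -> s g = r h ->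
  D (gprod gr A B).
Proof.
move=> DA DB Ag Bh gh; have [[_ _ _ _ prD] _] := castleD.
have [//|AB0] := prD A B DA DB.
by have := gprodP Ag Bh gh; rewrite AB0.
Qed.

Lemma bigcup_castle_ginv g : H g -> H (inv g).
Proof. by move=> [A DA Ag]; exists (inv @` A); [exact: castle_ginv|exists g]. Qed.

Lemma bigcup_castle_mul g h : H g -> H h -> s g = r h -> H (mul g h).
Proof.
move=> [A DA Ag] [B DB Bh] gh; exists (gprod gr A B); last exact: gprodP.
exact: castle_gprod gh.
Qed.

Lemma mem_rng_units (A : set G) g : A g -> rng_units gr A (e (r g)).
Proof. by move=> Ag; exists (r g) => //; exists g. Qed.

Lemma mem_src_units (A : set G) g : A g -> src_units gr A (e (s g)).
Proof. by move=> Ag; exists (s g) => //; exists g. Qed.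

(** The product of [A] with its inverse is a member with the same range and source as
    [rng_units gr A], hence equal to it by the last castle axiom. Quotients of arrows of [A] with a
    common source are therefore units. *)
Lemma castle_src_inj A : D A -> set_inj A s.
Proof.
move=> DA g h /set_mem Ag /set_mem Ah gh.
have DP : D (gprod gr A (inv @` A)).
  apply: (castle_gprod (g := g) (h := inv g)) => //; first exact: castle_ginv.
  by rewrite rng_inv.
have PE : gprod gr A (inv @` A) = rng_units gr A.
  have [_ injD] := castleD; apply: injD; rewrite ?inE//; first exact: castle_rng_units.
  congr pair; apply/seteqP; split.
  - move=> _ [_ [a [b [Aa _ ab ->]]] <-]; rewrite rng_mul//.
    by exists (e (r a)); [exact: mem_rng_units|rewrite rng_unit].
  - move=> _ [_ [_ [a Aa <-] <-] <-]; rewrite rng_unit.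
    exists (mul a (inv a)); last by rewrite rng_mul// rng_inv.
    by apply: gprodP => //; rewrite rng_inv.
  - move=> _ [_ [a [_ [Aa [b Ab <-] ab ->]]] <-]; rewrite src_mul// src_inv.
    by exists (e (r b)); [exact: mem_rng_units|rewrite src_unit].
  - move=> _ [_ [_ [a Aa <-] <-] <-]; rewrite src_unit.
    exists (mul a (inv a)); last by rewrite src_mul ?rng_inv// src_inv.
    by apply: gprodP => //; rewrite rng_inv.
have : gprod gr A (inv @` A) (mul g (inv h)).
  by apply: gprodP => //; rewrite rng_inv.
by rewrite PE => -[x _ /esym]; exact: gmulV_unit.
Qed.

Lemma castle_rng_inj A : D A -> set_inj A r.
Proof.
move=> DA g h /set_mem Ag /set_mem Ah gh; apply: (can_inj (ginvK gr)).
apply: (castle_src_inj (castle_ginv DA)); rewrite ?src_inv//.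
  by apply/mem_set; exists g.
by apply/mem_set; exists h.
Qed.

(** By disjointness, a member containing a unit equals its own [rng_units], so [A] is a level of the
    castle. *)
Definition same_level x y := exists A, [/\ D A, A (e x) & A (e y)].

Lemma same_level_rng A g h : D A -> A g -> A h -> same_level (r g) (r h).
Proof.
by move=> DA Ag Ah; exists (rng_units gr A); split;
  [exact: castle_rng_units|exact: mem_rng_units|exact: mem_rng_units].
Qed.

Lemma castle_same_eq A B g h : D A -> D B -> A g -> B h ->
  same_level (s g) (s h) -> same_level (r g) (r h) -> A = B.
Proof.
move=> DA DB Ag Bh [S [DS Sg Sh]] [T [DT Tg Th]].
have sAB : src_units gr A = src_units gr B.
  rewrite (castle_mem_eq (castle_src_units DA) DS (mem_src_units Ag) Sg).
  exact: (castle_mem_eq DS (castle_src_units DB) Sh (mem_src_units Bh)).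
have rAB : rng_units gr A = rng_units gr B.
  rewrite (castle_mem_eq (castle_rng_units DA) DT (mem_rng_units Ag) Tg).
  exact: (castle_mem_eq DT (castle_rng_units DB) Th (mem_rng_units Bh)).
have [_ injD] := castleD; apply: injD; rewrite ?inE//.
have srcE C : s @` src_units gr C = s @` C.
  by rewrite image_comp; under eq_imagel do rewrite /= src_unit; rewrite image_id.
have rngE C : r @` rng_units gr C = r @` C.
  by rewrite image_comp; under eq_imagel do rewrite /= rng_unit; rewrite image_id.
by rewrite -srcE -rngE sAB rAB srcE rngE.
Qed.

(** Members are determined by their end levels, and [s] is injective on each; hence a castle orbit
    meets each level at most once. *)
Lemma castle_eq A B g h : D A -> D B -> A g -> B h ->
  s g = s h -> same_level (r g) (r h) -> g = h.
Proof.
move=> DA DB Ag Bh gh lgh; have AB : A = B.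
  apply: (castle_same_eq DA DB Ag Bh _ lgh); rewrite -gh.
  exists (src_units gr A); split; first exact: castle_src_units.
    exact: mem_src_units.
  exact: mem_src_units.
by apply: (castle_src_inj DA); rewrite ?inE// AB.
Qed.

Lemma same_level_lift A g x : D A -> A g -> same_level (s g) x ->
  exists2 h, A h & s h = x.
Proof.
move=> DA Ag [S [DS Sg Sx]].
move: Sx; rewrite (castle_mem_eq DS (castle_src_units DA) Sg (mem_src_units Ag)).
by move=> [_ [h Ah <-] /(gunit_inj (gr := gr)) <-]; exists h.
Qed.

Lemma bigcup_castle_rng g : H g -> H (e (r g)).
Proof.
by move=> [A DA Ag]; exists (rng_units gr A); [exact: castle_rng_units|exact: mem_rng_units].
Qed.

Lemma bigcup_castle_src g : H g -> H (e (s g)).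
Proof.
by move=> [A DA Ag]; exists (src_units gr A); [exact: castle_src_units|exact: mem_src_units].
Qed.

(** Levels are numbered by their position in an enumeration of [D]. This orders all castle orbits
    consistently, as rank matching requires. *)
Lemma castle_index : exists (idx : X -> nat) (N : nat),
  (forall x, H (e x) -> (idx x < N)%N) /\
  (forall x y, H (e x) -> H (e y) -> idx x = idx y <-> same_level x y).
Proof.
have [[/finite_seqP[l lE] _ _ _ _] _] := castleD.
have Dl A : A \in l -> D A by rewrite lE.
have lD A : D A -> A \in l by rewrite lE.
pose p x A := `[< A (e x) >].
have hasx x : H (e x) -> has (p x) l.
  by move=> [A /lD Al Ax]; apply/hasP; exists A => //; exact/asboolP.
exists (fun x => find (p x) l), (size l); split=> [x /hasx|x y Hx Hy].
  by rewrite has_find.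
split=> [xy|[A [DA Ax Ay]]].
  exists (nth set0 l (find (p x) l)); split.
  - by apply: Dl; rewrite mem_nth// -has_find hasx.
  - by apply/asboolP; exact: (nth_find set0 (hasx x Hx)).
  - by rewrite xy; apply/asboolP; exact: (nth_find set0 (hasx y Hy)).
apply: eq_in_find => B /Dl DB; apply/asboolP/asboolP => [Bx|By].
  by rewrite (castle_mem_eq DB DA Bx Ax).
by rewrite (castle_mem_eq DB DA By Ay).
Qed.

End CastleAlgebra.

(** * Matching points of castle orbits by rank *)

Section CastleMatching.
Variables (X G : topologicalType) (gr : groupoid X G).
Hypotheses (top_gr : topological_groupoid gr) (etale_gr : etale gr).
Variable D : set (set G).
Hypothesis castleD : castle gr D.
Hypothesis openD : forall E, D E -> open E.
Local Notation s := (src gr).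
Local Notation r := (rng gr).
Local Notation e := (gunit gr).
Local Notation mul := (gmul gr).
Local Notation inv := (ginv gr).
Local Notation H := (\bigcup_(E in D) E).
Local Notation D0 := (e @^-1` H).
Variables (idx : X -> nat) (N : nat).
Hypothesis idx_lt : forall x, H (e x) -> (idx x < N)%N.
Hypothesis idxP : forall x y, H (e x) -> H (e y) -> idx x = idx y <-> same_level gr D x y.

Definition levels_in (Q : set X) (x : X) : pred nat := fun n =>
  `[< exists h, [/\ H h, s h = x, Q (r h) & idx (r h) = n] >].

(** Since a castle orbit has at most one point per level, this is the number of points of the orbit
    of [x] in [Q] on levels numbered below that of [x]. *)
Definition level_rank (Q : set X) (x : X) : nat :=
  count (levels_in Q x) (iota 0 (idx x)).

(* Clopen in the levels of the castle; this is what makes ranks locally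
   constant. *)
Definition castle_clopen (Q : set X) := open Q /\ open (D0 `\` Q).

Lemma idx_rng_eq A g h : D A -> A g -> A h -> idx (r g) = idx (r h).
Proof.
move=> DA Ag Ah; apply/idxP; last exact: same_level_rng DA Ag Ah.
- by apply: (bigcup_castle_rng castleD); exists A.
- by apply: (bigcup_castle_rng castleD); exists A.
Qed.

Lemma bigcup_castle_inj g h : H g -> H h -> s g = s h -> idx (r g) = idx (r h) -> g = h.
Proof.
move=> Hg Hh sgh igh; have := Hg; have := Hh => -[B DB Bh] [A DA Ag].
apply: (castle_eq castleD DA DB Ag Bh sgh).
by apply/idxP => //; exact: (bigcup_castle_rng castleD).
Qed.

(** Composition with [h] or its inverse identifies the castle arrows leaving [r h] and [s h]. *)
Lemma levels_in_src Q h : H h -> levels_in Q (r h) = levels_in Q (s h).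
Proof.
move=> Hh; apply/funext => n; apply/asboolP/asboolP => -[k [Hk kh Qk kn]].
  exists (mul k h); rewrite src_mul// rng_mul//; split=> //.
  exact: (bigcup_castle_mul castleD).
exists (mul k (inv h)); rewrite src_mul ?rng_inv// src_inv rng_mul ?rng_inv//.
split=> //; apply: (bigcup_castle_mul castleD) => //; rewrite ?rng_inv//.
exact: (bigcup_castle_ginv castleD).
Qed.

Lemma near_open_src (A : set G) g : open A -> A g ->
  \forall y \near s g, exists2 h, A h & s h = y.
Proof.
move=> oA Ag; have : nbhs (s g) (s @` A).
  by apply: open_nbhs_nbhs; split; [exact: open_src|exists g].
by apply: filterS => y [h Ah <-]; exists h.
Qed.

Lemma near_castle_unit A x : D A -> A (e x) -> \forall y \near x, A (e y).
Proof.
move=> DA Ax; apply: (open_nbhs_nbhs (A := e @^-1` A)); split=> //.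
by apply: open_preimage (openD DA); exact: gunit_cts.
Qed.

Lemma near_idx x : H (e x) -> \forall y \near x, idx y = idx x.
Proof.
move=> [A DA Ax]; apply: filterS (near_castle_unit DA Ax) => y Ay.
by apply/idxP; [exists A|exists A|exists A].
Qed.

(** A castle arrow from [x] to level [n] extends to nearby sources inside its member, and its range
    stays in [Q] or in the complement by clopenness. If there is no such arrow at [x], there is none
    nearby, since it could be carried to [x] along the common level. *)
Lemma near_levels_in Q x n : castle_clopen Q -> H (e x) ->
  \forall y \near x, levels_in Q y n = levels_in Q x n.
Proof.
move=> [oQ oDQ] [A DA Ax].
have near_true E h V : D E -> E h -> s h = x -> open V -> V (r h) ->
    \forall y \near x, exists h', [/\ E h', s h' = y, V (r h') & idx (r h') = idx (r h)].
  move=> DE Eh <- oV Vh.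
  have := @near_open_src (E `&` r @^-1` V) h.
  have oEV : open (E `&` r @^-1` V).
    by apply: openI; [exact: openD|apply: open_preimage oV; exact: rng_cts].
  move=> /(_ oEV (conj Eh Vh)); apply: filterS => y [h' [Eh' Vh'] sh'].
  by exists h'; split=> //; exact: idx_rng_eq DE Eh' Eh.
have [lx|nlx] := boolP (levels_in Q x n).
  have /asboolP[h [[E DE Eh] hx Qh hn]] := lx.
  have := near_true E h Q DE Eh hx oQ Qh; apply: filterS => y [h' [Eh' <- Qh' hh']].
  by apply/asboolP; exists h'; split=> //; [exists E|rewrite hh'].
have [[h [[E DE Eh] hx hn]]|nh] :=
    pselect (exists h, [/\ H h, s h = x & idx (r h) = n]).
  have nQh : (D0 `\` Q) (r h).
    split; first by apply: (bigcup_castle_rng castleD); exists E.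
    by move=> Qh; move/asboolP: nlx; apply; exists h; split=> //; exists E.
  have := near_true E h _ DE Eh hx oDQ nQh; apply: filterS => y [h' [Eh' h'y [_ nQh'] hh']].
  apply/asboolP => -[k [Hk ky Qk kn]]; apply: nQh'.
  suff -> : h' = k by [].
  by apply: bigcup_castle_inj; [exists E|by []|rewrite ky|rewrite hh' hn].
apply: filterS (near_castle_unit DA Ax) => y Ay.
apply/asboolP => -[k [[E DE Ek] ky Qk kn]]; apply: nh.
have [|h Eh hx] := same_level_lift castleD (x := x) DE Ek.
  by rewrite ky; exists A.
by exists h; split=> //; [exists E|rewrite -kn; exact: idx_rng_eq DE Eh Ek].
Qed.

Lemma near_level_rank Q x : castle_clopen Q -> H (e x) ->
  \forall y \near x, level_rank Q y = level_rank Q x.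
Proof.
move=> cQ Hx; apply: filterS2 (near_idx Hx) _; last first.
  apply: (@filter_forall _ 'I_N (fun n y => levels_in Q y n = levels_in Q x n)).
  by move=> n; exact: near_levels_in.
move=> y yx lyx; rewrite /level_rank yx; apply: eq_in_count => n.
rewrite mem_iota add0n => /andP[_ nx].
exact: (lyx (Ordinal (ltn_trans nx (idx_lt Hx)))).
Qed.

(* A point of [P] is matched with the point of [T] of the same rank in its orbit
   under the castle; this needs no choice of a base level in each tower. *)
Lemma castle_matching P T : castle_clopen P -> castle_clopen T ->
  P `<=` D0 ->
  (forall x F, P x -> uniq F ->
    (forall g, g \in F -> [/\ H g, s g = x & P (r g)]) ->
    exists F', [/\ uniq F', (forall g, g \in F' -> [/\ H g, s g = x & T (r g)]) &
      (size F <= size F')%N]) ->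
  subequivalent gr P T.
Proof.
move=> cP cT PD0 count_le.
have Hr h : H h -> H (e (r h)) by exact: (bigcup_castle_rng castleD).
have Hs h : H h -> H (e (s h)) by exact: (bigcup_castle_src castleD).
have levels_lt Q x n : levels_in Q x n -> (n < N)%N.
  by move=> /asboolP[h [Hh _ _ <-]]; apply: idx_lt; exact: Hr.
pose A := [set h | [/\ H h, P (r h), T (s h) & level_rank P (r h) = level_rank T (s h)]].
have oA : open A.
  apply: open_nbhs_subset => h Ah; suff : nbhs h A.
    by rewrite nbhsE => -[U [oU Uh] UA]; exists U.
  have [[E DE Eh] Ph Th rk] := Ah; have Hh : H h by exists E.
  have n1 : \forall k \near h, E k by apply: open_nbhs_nbhs; split=> //; exact: openD.
  have near_rank (f : G -> X) Q : continuous f -> castle_clopen Q -> Q (f h) ->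
      H (e (f h)) ->
      \forall k \near h, Q (f k) /\ level_rank Q (f k) = level_rank Q (f h).
    move=> cf cQ Qh Hf.
    have nQ : nbhs (f h) [set x | Q x /\ level_rank Q x = level_rank Q (f h)].
      apply: filterI; last exact: near_level_rank.
      by apply: open_nbhs_nbhs; split=> //; case: cQ.
    exact: cf h _ nQ.
  have n2 := near_rank r P (rng_cts top_gr) cP Ph (Hr _ Hh).
  have n3 := near_rank s T (src_cts top_gr) cT Th (Hs _ Hh).
  apply: filterS3 n1 n2 n3 => k Ek [Pk rkk] [Tk skk]; split=> //; first by exists E.
  by rewrite rkk rk skk.
(* Arrows of [A] with the same source end at points of [P] of the same rank in one orbit, hence on
   the same level. *)
have sA : set_inj A s.
  move=> g h /set_mem[Hg Pg Tg gk] /set_mem[Hh Ph Th hk] gh.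
  apply: bigcup_castle_inj => //.
  have lev k : H k -> P (r k) -> levels_in P (s k) (idx (r k)).
    by move=> Hk Pk; apply/asboolP; exists k.
  apply: (count_iota_inj (lev _ Hg Pg)); first by rewrite gh; exact: lev.
  by move: gk hk; rewrite /level_rank !levels_in_src// gh => -> ->.
exists A; split; first exact: open_s_section_inj.
- move=> x Px; have Hx : H (e x) by exact: PD0.
  have count_size (Q : set X) (F : seq G) : uniq F ->
      (forall g, g \in F -> [/\ H g, s g = x & Q (r g)]) ->
      (size F <= count (levels_in Q x) (iota 0 N))%N.
    move=> uF FQ; rewrite -(size_map (idx \o r)) -size_filter.
    apply: uniq_leq_size.
      rewrite map_inj_in_uniq// => g h /FQ[Hg gx _] /FQ[Hh hx _] /=.
      by apply: bigcup_castle_inj => //; rewrite gx.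
    move=> _ /mapP[g /FQ[Hg gx Qg] ->]; rewrite mem_filter mem_iota /= add0n.
    by rewrite idx_lt ?andbT; [apply/asboolP; exists g|exact: Hr].
  (* One arrow is picked for each level where the orbit of [x] meets [P], so [count_le] compares the
     number of these levels with that for [T]. The inequality is strict because [x] itself is
     counted. *)
  have rank_lt : (level_rank P x < count (levels_in T x) (iota 0 N))%N.
    have /choice[pick pickP] : forall n, exists h, levels_in P x n ->
        [/\ H h, s h = x, P (r h) & idx (r h) = n].
      move=> n; have [/asboolP[h hP]|nP] := boolP (levels_in P x n); first by exists h.
      by exists (e x).
    pose F := map pick [seq n <- iota 0 N | levels_in P x n].
    have uF : uniq F.
      rewrite map_inj_in_uniq ?filter_uniq ?iota_uniq// => n k.
      rewrite !mem_filter => /andP[/pickP[_ _ _ en] _] /andP[/pickP[_ _ _ ek] _].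
      by move=> nk; rewrite -en -ek nk.
    have FP g : g \in F -> [/\ H g, s g = x & P (r g)].
      by move=> /mapP[n]; rewrite mem_filter => /andP[/pickP[? ? ? _] _] ->.
    have [F' [uF' F'T FF']] := count_le x F Px uF FP.
    apply: leq_trans (count_size T F' uF' F'T); apply: leq_trans FF'.
    rewrite size_map size_filter; apply: count_iota_lt (idx_lt Hx).
    by apply/asboolP; exists (e x); rewrite src_unit rng_unit.
  have [t [tN /asboolP[h [Hh hx Th ht]] rk]] := count_iota_surj rank_lt.
  exists (inv h); rewrite ?rng_inv//; split; rewrite ?rng_inv ?src_inv ?hx//.
    exact: (bigcup_castle_ginv castleD).
  by rewrite -rk /level_rank levels_in_src// hx ht.
- by move=> _ [h [_ _ Th _] <-].
Qed.

Lemma castle_clopen_level A : D A -> castle_clopen (e @^-1` A).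
Proof.
move=> DA; split; first by apply: open_preimage (openD DA); exact: gunit_cts.
apply: open_nbhs_subset => x [[B DB Bx] nAx].
exists (e @^-1` B); split=> //.
  by apply: open_preimage (openD DB); exact: gunit_cts.
move=> y By; split; first by exists B.
by move=> Ay; apply: nAx; rewrite -/(A (e x)) /= -(castle_mem_eq castleD DB DA By Ay).
Qed.

Lemma castle_clopen_bigcup (I : choiceType) (l : seq I) (Q : I -> set X) :
  (forall i, i \in l -> castle_clopen (Q i)) ->
  castle_clopen (\bigcup_(i in [set` l]) Q i).
Proof.
move=> cQ; split; first by apply: bigcup_open => i /cQ[].
rewrite (_ : _ `\` _ = D0 `&` \bigcap_(i in [set` l]) (D0 `\` Q i)); last first.
  apply/seteqP; split=> [x [Dx nQ]|x [Dx DQ]]; split=> //.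
    by move=> i il; split=> // Qx; apply: nQ; exists i.
  by move=> [i il Qx]; have [] := DQ i il.
apply: openI.
  apply: open_preimage; first exact: gunit_cts.
  by apply: bigcup_open.
rewrite bigcap_seq big_seq; elim/big_ind: _ => [||i /cQ[]//]; first exact: openT.
by move=> A B; exact: openI.
Qed.

(* Over a level [C] on which [Z] is everywhere defined and takes values in the
   castle, the castle elements met by [Z] partition [C] into open pieces. *)
Lemma castle_clopen_image Z C : open Z -> set_inj Z s -> D C ->
  C `<=` range e -> (forall x, C (e x) -> (s @` Z) x) ->
  gprod gr Z C `<=` H ->
  castle_clopen (r @` (Z `&` s @^-1` (e @^-1` C))).
Proof.
move=> oZ sZ DC Cu CZ ZCH.
set ZC := Z `&` _.
have oC : open (e @^-1` C) by apply: open_preimage (openD DC); exact: gunit_cts.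
have oZC : open ZC by apply: openI => //; apply: open_preimage oC; exact: src_cts.
have ZCHs z : ZC z -> H z.
  move=> [Zz Cz]; apply: ZCH; rewrite -(mul_unitr gr z).
  by apply: gprodP => //; rewrite rng_unit.
split; first exact: open_rng.
apply: open_nbhs_subset => y [[A DA Ay] nRy].
(* Either some member [E] runs from [C] to the level of [y], or none does, and then that whole level
   avoids the image. *)
have [[E [DE [h Eh hy] [c Ec cC]]]|nE] :=
    pselect (exists E,
    [/\ D E, (exists2 h, E h & r h = y) & exists2 c, E c & C (e (s c))]).
- have Ch : C (e (s h)).
    have := mem_src_units gr Ec; have := mem_src_units gr Eh => uh uc.
    by rewrite (castle_mem_eq castleD DC (castle_src_units castleD DE) cC uc).
  have [z Zz zh] := CZ _ Ch.
  have ZCz : ZC z by split=> //; rewrite /= zh.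
  have [E' DE' E'z] := ZCHs _ ZCz.
  have EE' : E <> E'.
    move=> EE'; apply: nRy; exists z => //; rewrite -hy; congr r.
    by apply: (castle_src_inj castleD DE); rewrite ?inE// EE'.
  (* These are the arrows of [E] at whose sources [Z] follows the other member [E'], so their ranges
     are missed by the image. *)
  pose W := E `&` s @^-1` (s @` (ZC `&` E')).
  have oW : open W.
    apply: openI; first exact: openD.
    by apply: open_preimage; [exact: src_cts|apply: open_src => //; apply: openI => //; exact: openD].
  exists (r @` W); split; first exact: open_rng.
    by exists h => //; split=> //; exists z.
  move=> _ [k [Ek [z' [ZCz' E'z'] z'k]] <-]; split.
    by apply: (bigcup_castle_rng castleD); exists E.
  move=> [w ZCw wk]; apply: EE'; have [F DF Fw] := ZCHs _ ZCw.
  have FE : F = E.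
    apply: (castle_same_eq castleD DF DE Fw Ek).
      exists C; split=> //; first by case: ZCw.
      by rewrite -z'k; case: ZCz'.
    by rewrite wk; exact: (same_level_rng castleD DE Ek Ek).
  have wk' : w = k by apply: (castle_rng_inj castleD DE); rewrite ?inE// -FE.
  have z'w : z' = w by apply: sZ; rewrite ?inE; [case: ZCz'|case: ZCw|rewrite z'k wk'].
  apply: (castle_mem_eq castleD DE DE' Ek); rewrite -wk' -z'w //.
exists (e @^-1` A); split=> //.
  by apply: open_preimage (openD DA); exact: gunit_cts.
move=> x Ax; split; first by exists A.
move=> [w ZCw wx]; apply: nE; have [F DF Fw] := ZCHs _ ZCw.
exists F; split=> //; last by exists w => //; case: ZCw.
have : F `&` r @^-1` [set y] !=set0.
  have Fiw : (inv @` F) (inv w) by exists w.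
  have [|h [k Fk <-] hy] := same_level_lift castleD (x := y) (castle_ginv castleD DF) Fiw.
    by rewrite src_inv wx; exists A.
  by exists k; split=> //=; rewrite -hy src_inv.
by move=> [k [Fk ky]]; exists k.
Qed.

End CastleMatching.

(** * From expansion and almost elementariness to pure infiniteness *)

Section Comparison.
Variables (X G : topologicalType) (gr : groupoid X G).
Hypotheses (top_gr : topological_groupoid gr) (etale_gr : etale gr).
Hypothesis hausdorffG : hausdorff_space G.
Hypothesis locally_compactG : locally_compact [set: G].
Hypothesis compactX : compact [set: X].
Hypothesis minimal_gr : minimal gr.
Local Notation s := (src gr).
Local Notation r := (rng gr).
Local Notation e := (gunit gr).
Local Notation mul := (gmul gr).
Local Notation inv := (ginv gr).

Lemma subequivalentS (K L U V : set X) : K `<=` L -> U `<=` V ->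
  subequivalent gr L U -> subequivalent gr K V.
Proof.
move=> KL UV [A [sA LA AU]]; exists A; split=> //.
  exact: subset_trans LA.
exact: subset_trans UV.
Qed.

(** Disjointness of [U] and [V] keeps [s] injective on the union of the two sections. *)
Lemma subequivalentU (K L U V : set X) : U `&` V = set0 ->
  subequivalent gr K U -> subequivalent gr L V ->
  subequivalent gr (K `|` L) (U `|` V).
Proof.
move=> UV [A [[oA _ [[_ sA _] _ _]] KA AU]] [B [[oB _ [[_ sB _] _ _]] LB BV]].
exists (A `|` B); split.
- apply: open_s_section_inj => //; first exact: openU.
  have AB g h : A g -> B h -> s g <> s h.
    move=> Ag Bh gh; have : (U `&` V) (s g).
      by split; [apply: AU; exists g|rewrite gh; apply: BV; exists h].
    by rewrite UV.
  move=> g h /set_mem[Ag|Bg] /set_mem[Ah|Bh] gh.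
  + by apply: sA; rewrite ?inE.
  + by have := AB _ _ Ag Bh gh.
  + by have := AB _ _ Ah Bg (esym gh).
  + by apply: sB; rewrite ?inE.
- by rewrite image_setU; exact: setUSS.
- by rewrite image_setU; exact: setUSS.
Qed.

(* Membership of a level in the separating cover decides which of the bisections
   [U g] are defined on the whole level, so their translates [Z g] move it onto a
   set that is clopen in the castle, although [O2] itself is merely open. *)
Lemma castle_remainder_comparison (O1 O2 : set X) :
  almost_elementary gr ->
  (forall M, exists L, compact L /\ expands gr L M 1) ->
  open O1 -> O1 !=set0 -> open O2 -> O2 !=set0 ->
  exists P, subequivalent gr P O2 /\ subequivalent gr (~` P) O1.
Proof.
move=> ae exps oO1 O10 oO2 O20; have [y0 _] := O10.
have hX := hausdorff_units top_gr hausdorffG.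
have [lB [Q [lBP cQ lBcov]]] := exists_bisection_cover top_gr etale_gr
  hausdorffG locally_compactG compactX minimal_gr oO2 O20.
(* Moving by the bisections of [lB] can identify up to [size lB] arrows; expansion by that factor
   compensates. *)
have [L [cL eL]] := exps (size lB).
(* The compact cores [K g] serve to cover [L], the open sets [U g] around them carry the translates,
   and the compact bounds [W g] enter [K'']. *)
have /choice[B /choice[U /choice[W /choice[K BUWK]]]] : forall g : G,
    exists B U W K, [/\ B \in lB, U `<=` r @^-1` (s @` B), open U, set_inj U s & K `<=` U] /\
      [/\ U `<=` W, compact W, compact K & nbhs g K].
  move=> g; have [B BlB Bg] := lBcov (r g); have [oB _ _ _ _] := lBP B BlB.
  have orB : open (r @^-1` (s @` B)).
    by apply: open_preimage; [exact: rng_cts|exact: open_src].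
  have [U [W [[oU Ug UW cW WB] [sU _]]]] := precompact_bisection_basis top_gr
    etale_gr hausdorffG locally_compactG orB Bg.
  have [K [cK nK KU]] := compact_nbhs_in hausdorffG locally_compactG oU Ug.
  by exists B, U, W, K; split; split=> //; exact: subset_trans WB.
have [|l [lL Lcov]] := compact_nbhs_cover (K := L) (U := K) cL.
  by move=> g _; have [_ []] := BUWK g.
pose Z g := gprod gr (B g) (U g).
have oZ g : open (Z g).
  have [[BlB _ oU _ _] _] := BUWK g; have [oB _ _ _ _] := lBP _ BlB.
  exact: gprod_open.
have sZ g : set_inj (Z g) s.
  have [[BlB _ _ sU _] _] := BUWK g; have [_ sB _ _ _] := lBP _ BlB.
  exact: gprod_inj_src.
(* The castle is taken extendable along this compact set, which contains every [Z g] with [g] in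
   [l]. *)
pose K'' := gprod gr Q (\big[setU/set0]_(g <- l) W g).
have cK'' : compact K''.
  apply: gprod_compact => //.
  by apply: bigsetU_compact => g _; have [_ []] := BUWK g.
have ZK'' g : g \in l -> Z g `<=` K''.
  move=> gl; have [[BlB _ _ _ _] [UW _ _ _]] := BUWK g.
  have [_ _ _ _ BQ] := lBP _ BlB.
  apply: gprodS => // h Uh; rewrite -bigcup_seq; exists g => //; exact: UW.
have [|V [finV oV covV sepV]] := separating_cover (l := l)
    (U := fun g => s @` U g) (K := fun g => s @` K g).
  move=> g gl; have [[_ _ oU _ KU] [_ _ cK _]] := BUWK g; split.
  - exact: open_src.
  - apply: compact_closed => //; apply: continuous_compact => //.
    by apply: continuous_subspaceT; exact: src_cts.
  - exact: image_subset.
have [S [[[castleS oS] S0] [D [[castleD oD] SD]] SV remS]] :=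
  ae K'' V O1 cK'' finV oV covV oO1 O10.
exists (e @^-1` (\bigcup_(C in castle_units gr S) C)); split=> //.
set P := e @^-1` _.
have [lS lSE] : exists lS : seq (set G), castle_units gr S = [set` lS].
  apply/finite_seqP; have [[finS _ _ _ _] _] := castleS.
  by apply: sub_finite_set finS => C [].
have lSP C : C \in lS -> S C /\ C `<=` range e.
  by move=> Cl; have : castle_units gr S C by rewrite lSE.
have SH C A : A `<=` K'' -> S C -> gprod gr A C `<=` \bigcup_(E in D) E.
  move=> AK /SD[_ KC _]; apply: subset_trans KC; apply: gprodS => // g Ag.
  by left; exact: AK.
have DS C : S C -> D C by move=> /SD[].
have [idx [N [idx_lt idxP]]] := castle_index castleD.
pose R (p : set G * G) := r @` (Z p.2 `&` s @^-1` (e @^-1` p.1)).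
(* [castle_clopen_image] applies only where [Z g] is defined on the whole level. *)
pose pairs := [seq p <- [seq (C, g) | C <- lS, g <- l] | `[< p.1 `<=` e @` (s @` U p.2) >]].
have pairsP p : p \in pairs -> [/\ p.1 \in lS, p.2 \in l & p.1 `<=` e @` (s @` U p.2)].
  by rewrite mem_filter => /andP[/asboolP Up /allpairsP[q [q1 q2 pq]]]; rewrite pq in Up *.
pose T := \bigcup_(p in [set` pairs]) R p.
have sUZ g x : (s @` U g) x -> (s @` Z g) x.
  move=> [u Uu <-]; have [[_ UB _ _ _] _] := BUWK g.
  have [b Bb bu] := UB _ Uu.
  by exists (mul b u); [exact: gprodP|rewrite src_mul].
have cT : castle_clopen gr D T.
  apply: castle_clopen_bigcup => // p /pairsP[pS pl pU].
  have [Sp pu] := lSP _ pS.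
  apply: castle_clopen_image => //.
  - exact: DS.
  - move=> x px; apply: sUZ; have [z sz zx] := pU _ px.
    by rewrite -(gunit_inj zx).
  - by apply: SH => //; exact: ZK''.
have cP : castle_clopen gr D P.
  have -> : P = \bigcup_(C in [set` lS]) (e @^-1` C).
    by rewrite /P lSE preimage_bigcup.
  apply: castle_clopen_bigcup => // C /lSP[SC _].
  by apply: castle_clopen_level => //; exact: DS.
have TO2 : T `<=` O2.
  move=> _ [p _ [_ [[b [u [Bb Uu bu ->]] _]] <-]].
  have [[BlB _ _ _ _] _] := BUWK p.2; have [_ _ _ rB _] := lBP _ BlB.
  by apply: rB; exists b => //; rewrite rng_mul.
apply: (subequivalentS (@subset_refl _ _) TO2).
apply: (castle_matching top_gr etale_gr castleD oD idx_lt idxP cP cT).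
  by move=> x [C [SC _] Cx]; exists C => //; exact: DS.
(* Expansion turns [F] into [E], at least [size lB] times as long; each arrow of [E] is then moved
   into [T]. *)
move=> x F Px uF FP; have [E [uE EF sE]] := eL F uF.
have /choice[b bP] : forall h, exists b, h \in E ->
    [/\ exists2 A, A \in lB & A b, s b = r h,
      (\bigcup_(E in D) E) (mul b h), s (mul b h) = x & T (r (mul b h))].
  move=> h; have [/EF[k [g [Lk /= gF kg ->]]]|nE] := boolP (h \in E); last by exists h.
  have [Hg gx [C [SC Cu] Cg]] := FP _ gF.
  have [k0 k0l Kk] := Lcov _ Lk.
  have [[BlB UB _ _ KU] _] := BUWK k0.
  have Uk := KU _ Kk; have [b Bb bk] := UB _ Uk.
  have [W0 VW0 CW0] := SV C (conj SC Cu).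
  have [z W0z ez] := CW0 _ Cg; have zg := gunit_inj ez.
  (* The cover member around the level meets the source of [K k0], so it lies inside the source of
     [U k0]. *)
  have CU : C `<=` e @` (s @` U k0).
    have [WU|WK] := sepV W0 k0 VW0 k0l.
      by apply: subset_trans CW0 _; exact: image_subset.
    have : (W0 `&` s @` K k0) (s k) by split; [rewrite kg -zg|exists k].
    by rewrite WK.
  have Zbk : Z k0 (mul b k) by exact: gprodP.
  have sbk : s (mul b k) = r g by rewrite src_mul.
  exists b => _; rewrite rng_mul// mul_assoc//.
  split; first by exists (B k0).
  - by rewrite bk.
  - apply: (bigcup_castle_mul castleD) => //.
    apply: (SH C (Z k0) (ZK'' _ k0l) SC).
    by rewrite -(mul_unitr gr (mul b k)) sbk; apply: gprodP => //; rewrite rng_unit.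
  - by rewrite src_mul.
  - rewrite rng_mul//; exists (C, k0).
      rewrite /= mem_filter; apply/andP; split; first exact/asboolP.
      by apply/allpairsP; exists (C, k0); split=> //; have : [set` lS] C by rewrite -lSE.
    by exists (mul b k) => //; split=> //=; rewrite sbk.
pose F' := undup [seq mul (b h) h | h <- E]; exists F'; split.
- exact: undup_uniq.
- by move=> g; rewrite mem_undup => /mapP[h /bP[_ _ ? ? ?] ->].
- have lB0 : (0 < size lB)%N by have [B0] := lBcov y0; case: (lB).
  have : (size E <= size lB * size F')%N.
    apply: (@transported_size _ _ gr) => //.
      by move=> A /lBP[].
    move=> h hE; have [[A AlB Ab] bh _ _ _] := bP h hE.
    by exists A, (b h); split=> //; rewrite mem_undup; exact: map_f.
  by rewrite mul1n in sE; move=> /(leq_trans sE); rewrite leq_pmul2l.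
Qed.

Lemma almost_elementary_purely_infinite : topologically_principal gr ->
  almost_elementary gr ->
  (forall M, exists L, compact L /\ expands gr L M 1) ->
  purely_infinite gr.
Proof.
move=> principal_gr ae exps O1 O2 _ _ oO2 O20 _ K _ _.
have split2 := open_subset_split top_gr etale_gr hausdorffG locally_compactG
  compactX minimal_gr principal_gr exps.
(* The levels go into [V2] and the remainder into [V1]; disjointness joins both into one section
   whose range is [X]. *)
have small O : open O -> O !=set0 -> subequivalent gr setT O.
  move=> oO O0; have [V1 [V2 [[oV1 V10 V1O] [oV2 V20 V2O] V12]]] := split2 O oO O0.
  have [P [PV2 PV1]] := castle_remainder_comparison ae exps oV1 V10 oV2 V20.
  apply: (subequivalentS (L := P `|` ~` P) (U := V2 `|` V1)).
  - by rewrite setUCr.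
  - by rewrite subUset.
  - by apply: subequivalentU => //; rewrite setIC.
have [V1 [V2 [[oV1 V10 V1O] [oV2 V20 V2O] V12]]] := split2 O2 oO2 O20.
exists V1, V2; split=> //.
- by apply: (subequivalentS (@subsetT _ _) (@subset_refl _ _)); exact: small.
- by apply: (subequivalentS (@subsetT _ _) (@subset_refl _ _)); exact: small.
Qed.

End Comparison.

(** * Purely infinite groupoids *)

Section InvariantMeasure.
Variables (R : realType) (X G : topologicalType) (gr : groupoid X G).
Hypotheses (top_gr : topological_groupoid gr) (etale_gr : etale gr).
Hypothesis compactX : compact [set: X].
Local Notation s := (src gr).
Local Notation r := (rng gr).
Local Open Scope ereal_scope.

Variables (x0 : X) (P : probability (borel_type x0) R).
Hypothesis P_inv : forall U, open_bisection gr U -> P (s @` U) = P (r @` U).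

Lemma measurable_open (U : set X) : open U -> measurable (U : set (borel_type x0)).
Proof. by move=> oU; exact: sub_sigma_algebra. Qed.

(* Only differences of nested open sets occur, so that invariance under open
   bisections suffices. *)
Lemma measure_rng_le_src (A : set G) (I : choiceType) (l : seq I) (U : I -> set G) :
  set_inj A s ->
  (forall i, i \in l -> [/\ open (U i), set_inj (U i) r & U i `<=` A]) ->
  P (r @` (\bigcup_(i in [set` l]) U i)) <= P (s @` (\bigcup_(i in [set` l]) U i)).
Proof.
move=> sA; elim: l => [|i l IH] lP.
  by rewrite set_nil bigcup_set0 !image_set0.
have [oU rU UA] := lP i (mem_head _ _).
have {}IH := IH (fun j jl => lP j (mem_behead (s := i :: l) jl)).
rewrite bigcup_seq big_cons -bigcup_seq; set V := \bigcup_(j in _) _ in IH *.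
have oV : open V.
  by apply: bigcup_open => j jl; have [] := lP j (mem_behead (s := i :: l) jl).
have VA : V `<=` A.
  by move=> g [j jl]; have [_ _] := lP j (mem_behead (s := i :: l) jl); exact.
have sU : set_inj (U i) s by move=> g h /set_mem/UA Ag /set_mem/UA Ah; apply: sA; exact: mem_set.
(* This is the part of [U i] whose ranges [V] already covers. Removing it makes the ranges disjoint;
   the sources become disjoint too, since by injectivity of [s] on [A] a common source comes from a
   common arrow. *)
pose B := U i `&` r @^-1` (r @` V).
have oB : open B.
  by apply: openI => //; apply: open_preimage; [exact: rng_cts|exact: open_rng].
have BU : B `<=` U i by exact: subIsetl.
have bisB : open_bisection gr B.
  by apply: open_bisection_inj => // g h /set_mem/BU Ug /set_mem/BU Uh;
    [apply: sU|apply: rU]; exact: mem_set.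
have bisU : open_bisection gr (U i) by exact: open_bisection_inj.
have mr (Y : set G) : open Y -> measurable (r @` Y : set (borel_type x0)).
  by move=> oY; apply: measurable_open; exact: open_rng.
have ms (Y : set G) : open Y -> measurable (s @` Y : set (borel_type x0)).
  by move=> oY; apply: measurable_open; exact: open_src.
have finP (Y : set (borel_type x0)) : measurable Y -> P Y < +oo.
  by move=> mY; rewrite (le_lt_trans (probability_le1 P mY))// ltry.
have rE : r @` (U i `|` V) = (r @` V) `|` (r @` U i `\` r @` B).
  apply/seteqP; split=> [_ [g [Ug|Vg] <-]|x [[g Vg <-]|[[g Ug <-] _]]].
  - have [rV|nrV] := pselect ((r @` V) (r g)); first by left.
    right; split; first by exists g.
    by move=> [h [Uh rh] hg]; apply: nrV; rewrite -hg.
  - by left; exists g.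
  - by exists g => //; right.
  - by exists g => //; left.
have sE : (s @` V) `|` (s @` U i `\` s @` B) `<=` s @` (U i `|` V).
  move=> x [[g Vg <-]|[[g Ug <-] _]]; first by exists g => //; right.
  by exists g => //; left.
have eqD : P (r @` U i `\` r @` B) = P (s @` U i `\` s @` B).
  have BE (f : G -> X) : f @` U i `&` f @` B = f @` B.
    by apply: setIidr; exact: image_subset.
  rewrite (measureD (mr _ oU) (mr _ oB) (finP _ (mr _ oU))).
  rewrite (measureD (ms _ oU) (ms _ oB) (finP _ (ms _ oU))).
  by rewrite (BE r) (BE s); congr (_ - _); apply/esym; exact: P_inv.
have mrD : measurable (r @` U i `\` r @` B : set (borel_type x0)).
  by apply: measurableD; exact: mr.
have msD : measurable (s @` U i `\` s @` B : set (borel_type x0)).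
  by apply: measurableD; exact: ms.
have -> : P (r @` (U i `|` V)) = P (r @` V) + P (r @` U i `\` r @` B).
  rewrite rE measureU//; first exact: mr.
  rewrite -subset0 => _ [[g Vg <-] [[h Uh hg] nB]]; apply: nB.
  by exists h => //; split=> //; exists g.
apply: (@le_trans _ _ (P ((s @` V) `|` (s @` U i `\` s @` B)))); last first.
  apply: le_measure => //; rewrite inE.
  - by apply: measurableU => //; exact: ms.
  - by apply: ms; exact: openU.
rewrite measureU//; [|exact: ms|].
  by rewrite eqD leeD2r.
rewrite -subset0 => _ [[g Vg <-] [[h Uh hg] nB]]; apply: nB.
have -> : g = h by apply: sA; [apply/mem_set/VA|apply/mem_set/UA|].
exists h => //; split=> //; exists g => //; congr r; apply: sA => //.
  exact/mem_set/VA.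
exact/mem_set/UA.
Qed.

(** Although [r] may fail to be injective on the section [A], compactness covers [X] by the ranges
    of finitely many bisections inside [A], whose sources lie in [V]. *)
Lemma subequivalent_setT_measure (V : set X) : open V -> subequivalent gr setT V ->
  P V = 1.
Proof.
move=> oV [A [[oA _ [[_ sA _] _ _]] TA AV]].
have /choice[U UP] : forall x, exists U, [/\ open U, (r @` U) x, U `<=` A & set_inj U r].
  move=> x; have [g Ag gx] := TA x I.
  have [U [oU Ug UA _ rU]] := bisection_basis top_gr etale_gr oA Ag.
  by exists U; split=> //; exists g.
have [|l [_ lcov]] := compact_nbhs_cover (U := fun x => r @` U x) compactX.
  move=> x _; have [oU rx _ _] := UP x.
  by apply: open_nbhs_nbhs; split=> //; exact: open_rng.
have := measure_rng_le_src (l := l) (U := U) sA.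
have lP i : i \in l -> [/\ open (U i), set_inj (U i) r & U i `<=` A].
  by move=> _; have [] := UP i.
move=> /(_ lP).
have -> : r @` (\bigcup_(i in [set` l]) U i) = setT.
  apply/seteqP; split=> // x _; have [y yl [g Ug gx]] := lcov x I.
  by exists g => //; exists y.
rewrite probability_setT => le1.
apply/eqP; rewrite eq_le probability_le1 ?(le_trans le1)//; last exact: measurable_open.
apply: le_measure; rewrite ?inE; [|exact: measurable_open|].
  apply: measurable_open; apply: open_src => //.
  by apply: bigcup_open => i _; have [] := UP i.
move=> _ [g [i _ Ug] <-]; apply: AV; exists g => //.
by have [_ _ UA _] := UP i; exact: UA.
Qed.

End InvariantMeasure.

(** * Excluding invariant probabilities and building castles *)

Section PurelyInfinite.
Variables (X G : topologicalType) (gr : groupoid X G).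
Hypotheses (top_gr : topological_groupoid gr) (etale_gr : etale gr).
Hypothesis hausdorffG : hausdorff_space G.
Hypothesis compactX : compact [set: X].
Hypothesis minimal_gr : minimal gr.
Local Notation s := (src gr).
Local Notation r := (rng gr).
Local Notation e := (gunit gr).
Local Notation mul := (gmul gr).
Local Notation inv := (ginv gr).

Lemma purely_infinite_setT O : purely_infinite gr -> open O -> O !=set0 ->
  exists V1 V2 : set X, [/\ [/\ open V1, V1 !=set0 & V1 `<=` O],
          [/\ open V2, V2 !=set0 & V2 `<=` O],
          V1 `&` V2 = set0,
          subequivalent gr setT V1 &
          subequivalent gr setT V2].
Proof.
move=> pi oO O0; apply: (pi setT O) => //; first exact: openT.
  by have [x _] := O0; exists x.
by rewrite saturation_setT.
Qed.

Lemma purely_infinite_no_invariant_probability (R : realType) :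
  purely_infinite gr -> invariant_probabilities R gr = set0.
Proof.
move=> pi; rewrite -subset0 => mu [[x0 [P muP]] mu_inv].
have P_inv U : open_bisection gr U -> P (s @` U) = P (r @` U).
  by rewrite -!muP; exact: mu_inv.
have [|V1 [V2 [[oV1 _ _] [oV2 _ _] V12 TV1 TV2]]] := purely_infinite_setT pi openT.
  by exists x0.
have P1 := subequivalent_setT_measure top_gr etale_gr compactX P_inv oV1 TV1.
have P2 := subequivalent_setT_measure top_gr etale_gr compactX P_inv oV2 TV2.
have m1 := measurable_open (x0 := x0) oV1; have m2 := measurable_open (x0 := x0) oV2.
have := probability_le1 P (measurableU _ _ m1 m2).
have PU : P (V1 `|` V2) = (P V1 + P V2)%E by exact: measureU.
rewrite PU P1 P2 -EFinD lee_fin; lra.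
Qed.

(** The products [L i j] of [T i] with the inverse of [T j] behave as matrix units: disjointness of
    the ranges makes [L i j] and [L k m] composable only for [j = k], and the common source [W] then
    makes the product [L i m]. *)
Lemma bisection_castle (I : choiceType) (l : seq I) (T : I -> set G) (W : set X) :
  W !=set0 ->
  (forall i, i \in l -> [/\ set_inj (T i) s, set_inj (T i) r & s @` T i = W]) ->
  (forall i j x, i \in l -> j \in l -> (r @` T i) x -> (r @` T j) x -> i = j) ->
  castle gr [set gprod gr (T p.1) (inv @` T p.2) | p in [set` [seq (i, j) | i <- l, j <- l]]].
Proof.
move=> [w0 W0] lP ldis.
pose L i j := gprod gr (T i) (inv @` T j).
have LP i j g : L i j g -> exists a b, [/\ T i a, T j b, s a = s b & g = mul a (inv b)].
  by move=> [a [_ [Ta [b Tb <-] ab ->]]]; exists a, b; rewrite rng_inv in ab.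
have LI i j a b : T i a -> T j b -> s a = s b -> L i j (mul a (inv b)).
  by move=> Ta Tb ab; apply: gprodP => //; rewrite rng_inv.
have lift i a j : i \in l -> j \in l -> T i a -> exists2 b, T j b & s a = s b.
  move=> il jl Ta; have [_ _ sj] := lP j jl; have [_ _ si] := lP i il.
  have : (s @` T j) (s a) by rewrite sj -si; exists a.
  by move=> [b Tb ba]; exists b.
have rL i j : i \in l -> j \in l -> r @` L i j = r @` T i.
  move=> il jl; apply/seteqP; split=> [_ [_ /LP[a [b [Ta Tb ab ->]]] <-]|_ [a Ta <-]].
    by exists a => //; rewrite rng_mul// rng_inv.
  have [b Tb ab] := lift i a j il jl Ta.
  by exists (mul a (inv b)); [exact: LI|rewrite rng_mul// rng_inv].
have invL i j : inv @` L i j = L j i.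
  apply/seteqP; split=> [_ [_ /LP[a [b [Ta Tb ab ->]]] <-]|_ /LP[b [a [Tb Ta ba ->]]]].
    by rewrite ginvM ?rng_inv// ginvK; exact: LI.
  exists (mul a (inv b)); first exact: LI.
  by rewrite ginvM ?rng_inv// ginvK.
have sL i j : i \in l -> j \in l -> s @` L i j = r @` T j.
  move=> il jl; rewrite -(rL j i jl il) -(invL i j) image_comp.
  by apply: eq_imagel => g _ /=; rewrite rng_inv.
have Lii i : i \in l -> L i i = e @` (r @` T i).
  move=> il; have [si _ _] := lP i il.
  apply/seteqP; split=> [_ /LP[a [b [Ta Tb ab ->]]]|_ [_ [a Ta <-] <-]].
    have -> : a = b by apply: si => //; exact: mem_set.
    by rewrite mul_invr; exists (r b) => //; exists b.
  by rewrite -mul_invr; exact: LI.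
have Lprod i j m : i \in l -> j \in l -> m \in l -> gprod gr (L i j) (L j m) = L i m.
  move=> il jl ml; have [_ rj _] := lP j jl.
  apply/seteqP; split.
    move=> _ [_ [_ [/LP[a [b [Ta Tb ab ->]]] /LP[b' [c [Tb' Tc bc ->]]] +  ->]]].
    rewrite src_mul ?rng_inv// src_inv rng_mul ?rng_inv// => bb'.
    have {}bb' : b = b' by apply: rj => //; exact: mem_set.
    subst b'; rewrite mul_assoc.
    - by rewrite gmulgVK//; apply: LI => //; rewrite ab.
    - by rewrite src_mul ?rng_inv// src_inv.
    - by rewrite rng_inv.
  move=> _ /LP[a [c [Ta Tc ac ->]]]; have [b Tb ab] := lift i a j il jl Ta.
  have -> : mul a (inv c) = mul (mul a (inv b)) (mul b (inv c)).
    rewrite mul_assoc ?gmulgVK//.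
    - by rewrite src_mul ?rng_inv// src_inv.
    - by rewrite rng_inv -ab.
  apply: gprodP; [exact: LI|by apply: LI; rewrite -?ab|].
  by rewrite src_mul ?rng_inv// src_inv rng_mul// rng_inv -ab.
have mem i j : i \in l -> j \in l ->
    [set gprod gr (T p.1) (inv @` T p.2) | p in [set` [seq (i, j) | i <- l, j <- l]]] (L i j).
  by move=> il jl; exists (i, j) => //=; apply/allpairsP; exists (i, j).
have ij p : p \in [seq (i, j) | i <- l, j <- l] -> p.1 \in l /\ p.2 \in l.
  by move=> /allpairsP[q [q1 q2 ->]].
have rT0 i : i \in l -> (r @` T i) !=set0.
  move=> il; have [_ _ si] := lP i il; have : (s @` T i) w0 by rewrite si.
  by move=> [g Tg _]; exists (r g); exists g.
split; first split.
- exact: finite_image.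
- move=> _ _ [[i j] /ij[/= il jl] <-] [[k m] /ij[/= kl ml] <-] [g [Lg Lg']].
  have ik : i = k.
    apply: (ldis _ _ (r g)) => //; first by rewrite -(rL i j)//; exists g.
    by rewrite -(rL k m)//; exists g.
  have jm : j = m.
    apply: (ldis _ _ (s g)) => //; first by rewrite -(sL i j)//; exists g.
    by rewrite -(sL k m)//; exists g.
  by rewrite ik jm.
- move=> _ [[i j] /ij[/= il jl] <-].
  have [_ [a Ta _]] := rT0 i il; have [b Tb ab] := lift i a j il jl Ta.
  by exists (mul a (inv b)); exact: LI.
- move=> _ [[i j] /ij[/= il jl] <-]; rewrite -/(L i j) /rng_units /src_units.
  rewrite rL// sL// -!Lii// invL.
  by split; exact: mem.
- move=> _ _ [[i j] /ij[/= il jl] <-] [[k m] /ij[/= kl ml] <-].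
  rewrite -/(L i j) -/(L k m); have [<-|jk] := eqVneq j k.
    by left; rewrite Lprod//; exact: mem.
  right; rewrite -subset0 => f [g [h [Lg Lh gh _]]].
  move/eqP: jk; apply; apply: (ldis _ _ (s g)) => //.
    by rewrite -(sL i j)//; exists g.
  by rewrite -(rL k m)// gh; exists h.
- move=> _ _ /set_mem[[i j] /ij[/= il jl] <-] /set_mem[[k m] /ij[/= kl ml] <-].
  rewrite -/(L i j) -/(L k m) !rL// !sL// => -[rik rjm].
  have [x rx] := rT0 i il; have [y ry] := rT0 j jl.
  have -> : i = k by apply: (ldis _ _ x) => //; rewrite -rik.
  by have -> : j = m by apply: (ldis _ _ y) => //; rewrite -rjm.
Qed.

End PurelyInfinite.

(** * From pure infiniteness to almost elementariness *)

Section AlmostElementary.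
Variables (X G : topologicalType) (gr : groupoid X G).
Hypotheses (top_gr : topological_groupoid gr) (etale_gr : etale gr).
Hypothesis hausdorffG : hausdorff_space G.
Hypothesis compactX : compact [set: X].
Hypothesis minimal_gr : minimal gr.
Local Notation s := (src gr).
Local Notation r := (rng gr).
Local Notation e := (gunit gr).
Local Notation mul := (gmul gr).
Local Notation inv := (ginv gr).

(** Finitely many sets on which [s] is injective cover [K], and each contains at most one arrow with
    source [x]. *)
Lemma compact_src_fiber_finite K x : compact K -> finite_set (K `&` s @^-1` [set x]).
Proof.
move=> cK.
have /choice[U UP] : forall g, exists U, [/\ open U, U g & set_inj U s].
  move=> g; have [U [oU Ug _ sU _]] := bisection_basis top_gr etale_gr openT (I : setT g).
  by exists U.
have [|l [_ lcov]] := compact_nbhs_cover (U := U) cK.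
  by move=> g _; have [oU Ug _] := UP g; exact: open_nbhs_nbhs.
have /choice[c cP] : forall g, exists h, (exists2 k, U g k & s k = x) -> U g h /\ s h = x.
  move=> g; have [[h Uh hx]|nh] := pselect (exists2 k, U g k & s k = x).
    by exists h.
  by exists g.
apply: (sub_finite_set (B := c @` [set` l])); last exact: finite_image.
move=> g [Kg gx]; have [h hl Uhg] := lcov g Kg; exists h => //.
have [|Uc cx] := cP h; first by exists g.
have [_ _ sU] := UP h; apply: sU; [exact: mem_set|exact: mem_set|].
by rewrite cx gx.
Qed.

Lemma purely_infinite_almost_elementary : topologically_principal gr ->
  purely_infinite gr -> almost_elementary gr.
Proof.
move=> principal_gr pi K V O cK finV oV covV oO O0.
have hX := hausdorff_units top_gr hausdorffG.
have [x [_ tx]] : [set: X] `&` [set x | trivial_isotropy gr x] !=set0.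
  by apply: principal_gr; [have [y _] := O0; exists y|exact: openT].
(* Including the inverse of [K] serves both sides of extendability, and [e x] provides the base
   level. *)
pose K1 := (K `|` inv @` K) `|` [set e x].
have cK1 : compact K1.
  apply: compactU; last exact: compact_set1.
  apply: compactU => //; apply: continuous_compact => //.
  by apply: continuous_subspaceT; exact: ginv_cts.
have [l lE] : exists l : seq G, K1 `&` s @^-1` [set x] = [set` l].
  by apply/finite_seqP; exact: compact_src_fiber_finite.
have lP g : g \in l -> K1 g /\ s g = x.
  by move=> gl; have : [set` l] g by []; rewrite -lE.
have lI g : K1 g -> s g = x -> g \in l.
  by move=> Kg gx; have : (K1 `&` s @^-1` [set x]) g by []; rewrite lE.
have exl : e x \in l by apply: lI; [right|rewrite src_unit].
(* Trivial isotropy at [x] gives distinct arrows of [l] distinct ranges, which thus have disjoint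
   neighbourhoods. *)
have [Y [YP Ydis]] := hausdorff_separate_seq (map r l) hX.
have /choice[U UP] : forall g, exists U, g \in l ->
    [/\ open U, U g, U `<=` r @^-1` (Y (r g)), g = e x -> U `<=` range e &
      set_inj U s /\ set_inj U r].
  move=> g; have [gl|ngl] := boolP (g \in l); last by exists set0.
  have [oY Yg] := YP (r g) (map_f r gl).
  have oA : open (r @^-1` (Y (r g))) by apply: open_preimage oY; exact: rng_cts.
  (* At [e x] only units are kept, so that [T (e x)] is the set of units over [W]. *)
  pose A := r @^-1` (Y (r g)) `&` (if g == e x then range e else setT).
  have oA' : open A.
    apply: openI => //; case: ifP => _; [exact: open_units|exact: openT].
  have Ag : A g.
    by split=> //; case: ifPn => // /eqP ->; exists x.
  have [U [oU Ug UA sU rU]] := bisection_basis top_gr etale_gr oA' Ag.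
  exists U => _; split=> //; first by move=> h /UA[].
  by move=> gx h /UA[_]; rewrite gx eqxx.
(* Arrows of [K1] outside the chosen bisections do not start at [x]; keeping [W] off their closed
   set of sources forces every arrow of [K1] starting in [W] into some [T g]. *)
pose K2 := K1 `\` \bigcup_(g in [set` l]) U g.
have oUU : open (\bigcup_(g in [set` l]) U g).
  by apply: bigcup_open => g /UP[].
have cK2 : compact K2 by rewrite /K2 setDE; apply: compact_closedI => //; exact: open_closedC.
have clsK2 : closed (s @` K2).
  apply: compact_closed => //; apply: continuous_compact => //.
  by apply: continuous_subspaceT; exact: src_cts.
have nx : ~ (s @` K2) x.
  move=> [g [Kg nUg] gx]; apply: nUg; exists g; first exact: lI.
  by have [] := UP g (lI g Kg gx).
have [V0 VV0 V0x] : (\bigcup_(W in V) W) x by rewrite covV.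
pose W := (V0 `&` ~` (s @` K2)) `&` \bigcap_(g in [set` l]) s @` U g.
have oW : open W.
  apply: openI; first by apply: openI; [exact: oV|exact: closed_openC].
  rewrite bigcap_seq big_seq; elim/big_ind : _ => [||g /UP[oU _ _ _ _]].
  - exact: openT.
  - by move=> A B; exact: openI.
  - exact: open_src.
have Wx : W x.
  split=> // g gl; have [_ gx] := lP g gl; have [_ Ug _ _ _] := UP g gl.
  by exists g.
pose T g := U g `&` s @^-1` W.
have oT g : g \in l -> open (T g).
  by move=> /UP[oU _ _ _ _]; apply: openI => //; apply: open_preimage oW; exact: src_cts.
have TP g : g \in l -> [/\ set_inj (T g) s, set_inj (T g) r & s @` T g = W].
  move=> gl; have [_ _ _ _ [sU rU]] := UP g gl; split.
  - by move=> h k /set_mem[Uh _] /set_mem[Uk _]; apply: sU; exact: mem_set.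
  - by move=> h k /set_mem[Uh _] /set_mem[Uk _]; apply: rU; exact: mem_set.
  - apply/seteqP; split=> [_ [h [_ Wh] <-] //|y Wy].
    by have [_ /(_ g gl)[h Uh hy]] := Wy; exists h => //; split; rewrite //= hy.
have Tdis g h y : g \in l -> h \in l -> (r @` T g) y -> (r @` T h) y -> g = h.
  move=> gl hl [a [Ua _] <-] [b [Ub _] ba].
  have [_ _ UY _ _] := UP g gl; have [_ _ UY' _ _] := UP h hl.
  apply: (trivial_isotropy_inj tx).
  - by have [] := lP g gl.
  - by have [] := lP h hl.
  apply: contrapT => /eqP gh.
  have := Ydis _ _ (map_f r gl) (map_f r hl) gh; rewrite -subset0 => /(_ (r a)); apply.
  by split; [exact: UY|rewrite -ba; exact: UY'].
have W0 : W !=set0 by exists x.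
have castleD := bisection_castle W0 TP Tdis.
have TexE : T (e x) = e @` W.
  have [_ _ _ /(_ erefl) Uu _] := UP _ exl; apply/seteqP; split.
    by move=> g [/Uu[y _ <-]] /=; rewrite src_unit => Wy; exists y.
  move=> _ [y Wy <-]; have [_ /(_ (e x) exl)[u Uu' uy]] := Wy.
  have [z _ zu] := Uu _ Uu'.
  by rewrite -zu src_unit in uy; rewrite -uy; split; rewrite ?zu//= -zu src_unit uy.
have eWE : gprod gr (T (e x)) (inv @` T (e x)) = e @` W.
  rewrite TexE; apply/seteqP; split.
    move=> _ [_ [_ [[y Wy <-] [_ [z Wz <-] <-] yz ->]]].
    by rewrite rng_inv !src_unit in yz; rewrite yz mul_invr rng_unit; exists z.
  move=> _ [y Wy <-]; have -> : e y = mul (e y) (inv (e y)).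
    by rewrite mul_invr rng_unit.
  by apply: gprodP; [exists y|exists (e y) => //; exists y|rewrite rng_inv].
(* The one-level castle is the bisection castle of the list [[:: e x]]. *)
have [castleS oS] : open_castle gr [set e @` W].
  have exl1 g : g \in [:: e x] -> g \in l by rewrite inE => /eqP ->.
  have := bisection_castle W0 (fun g gl => TP g (exl1 g gl))
    (fun g h y gl hl => @Tdis g h y (exl1 g gl) (exl1 h hl)).
  rewrite /= set_cons1 image_set1 /= eWE => castleS; split=> // _ ->.
  exact: open_gunit.
set D := (X in castle gr X) in castleD.
have DP g h : g \in l -> h \in l -> D (gprod gr (T g) (inv @` T h)).
  by move=> gl hl; exists (g, h) => //=; apply/allpairsP; exists (g, h).
have K1T a : K1 a -> W (s a) -> exists2 g, g \in l & T g a.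
  move=> Ka Wa; have [[_ nK2] _] := Wa.
  have : (\bigcup_(g in [set` l]) U g) a.
    by apply: contrapT => nU; apply: nK2; exists a.
  by move=> [g gl Ug]; exists g.
have K1inv a : (K `|` inv @` K) a -> K1 (inv a).
  move=> [Ka|[b Kb <-]]; left; first by right; exists a.
  by left; rewrite ginvK.
have [V1 [V2 [[oV1 _ V1O] _ _ TV1 _]]] :=
  purely_infinite_setT top_gr etale_gr compactX minimal_gr pi oO O0.
exists [set e @` W]; split.
- by split; [split|exists (e @` W)].
- exists D; split.
    split=> // _ [[g h] /allpairsP[[g' h'] [/= gl hl [-> ->]]] <-].
    by apply: gprod_open; [..|exact: oT|apply: open_ginv; [..|exact: oT]].
  move=> _ ->; split.
  + by rewrite -eWE; exact: DP.
  + move=> _ [a [_ [Ka [w Ww <-] aw ->]]]; rewrite rng_unit in aw.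
    rewrite -aw mul_unitr; have [g gl Tg] : exists2 g, g \in l & T g a.
      by apply: K1T; [left|rewrite aw].
    exists (gprod gr (T g) (inv @` T (e x))); first exact: DP.
    rewrite -(mul_unitr gr a) aw; apply: gprodP => //; last by rewrite rng_unit.
    exists (e w); first by rewrite TexE; exists w.
    apply: (gmulgI (g := e w) (gr := gr)); rewrite ?rng_inv ?src_unit ?rng_unit//.
    by rewrite mul_invr rng_unit -{2}(rng_unit gr w) mul_unitl.
  + move=> _ [_ [a [[w Ww <-] Ka wa ->]]]; rewrite src_unit in wa.
    have [g gl Tg] : exists2 g, g \in l & T g (inv a).
      by apply: K1T; [exact: K1inv|rewrite src_inv -wa].
    exists (gprod gr (T (e x)) (inv @` T g)); first exact: DP.
    apply: gprodP; [by rewrite TexE; exists w| |by rewrite src_unit].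
    by exists (inv a) => //; rewrite ginvK.
- move=> _ [-> _]; exists V0 => //; apply: image_subset.
  by move=> y [[]].
- by apply: (subequivalentS (@subsetT _ _) V1O).
Qed.

End AlmostElementary.

Theorem proposition5p2 (R : realType) (X G : topologicalType)
    (gr : groupoid X G)
    (top_gr : topological_groupoid gr)
    (hausdorffG : hausdorff_space G)
    (locally_compactG : locally_compact [set: G])
    (sigma_compactG : sigma_compact G)
    (etale_gr : etale gr)
    (minimal_gr : minimal gr)
    (principal_gr : topologically_principal gr)
    (compact_units : compact [set: X]) :
  purely_infinite gr <->
  almost_elementary gr /\ invariant_probabilities R gr = set0.
Proof.
split=> [pi|[ae noM]].
  split; first exact: purely_infinite_almost_elementary.
  exact: purely_infinite_no_invariant_probability.
apply: almost_elementary_purely_infinite => // M.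
suff [K [n [cK eK]]] : exists K n, compact K /\ expands gr K n.+2 n.+1.
  exact: expands_large eK.
apply: contrapT => nex.
(* If no compact set expands by any factor [(n + 2) / (n + 1)], every compact set has Folner sets of
   every order. *)
have : invariant_probabilities R gr !=set0.
  apply: folner_invariant_probability => // K n cK.
  by apply: not_expands_folner => eK; apply: nex; exists K, n.
by rewrite noM => -[].
Qed.
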